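(* Let $p,q>0$ and put $s=p+q$ and $u=\dfrac{pq}{(p+q)^2}\in(0,1/4]$. Then $$D_2(\beta_{p,q})=\frac{u^3P_2(s,u)}{(s+1)^6(s+2)^4(s+3)^3(s+4)^2(s+5)},$$ where $P_2(s,u)=A_0(s)+uA_1(s)+u^2A_2(s)+u^3A_3(s)$ with $$A_0(s)=24s^2(s+1)^4(s+2),$$ $$A_1(s)=8s(s+1)^2\bigl(4s^5-17s^4-139s^3-292s^2-318s-216\bigr),$$ $$A_2(s)=4s(s+1)\bigl(3s^7-49s^6-125s^5+663s^4+3812s^3+9004s^2+11472s+5760\bigr),$$ $$A_3(s)=3s^{10}-18s^9+260s^8+1866s^7+1993s^6-16432s^5-81624s^4-180416s^3-210672s^2-127872s-34560.$$ Thus, if $P_2(s,u)<0$, then $\beta_{p,q}$ is not freely infinitely divisible.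
   Context: For $p,q>0$, $\beta_{p,q}$ denotes the beta distribution on $[0,1]$ with density $x^{p-1}(1-x)^{q-1}/B(p,q)$ on $(0,1)$, where $B$ is the Euler beta function. For a probability measure $\mu$ on $\mathbb{R}$ with finite moments $m_n(\mu)=\int x^n\,\mu(\mathrm{d}x)$, the free cumulants $\kappa_n(\mu)$, $n\ge 1$, are determined by $m_n(\mu)=\sum_{\pi\in NC(n)}\prod_{V\in\pi}\kappa_{|V|}(\mu)$ for all $n\geq 1$, where $NC(n)$ is the set of noncrossing partitions of $\{1,\dots,n\}$ and the product is over the blocks $V$ of $\pi$. $D_2(\mu)=\det[\kappa_{i+j+2}(\mu)]_{i,j=0}^{2}$ (a $3\times3$ Hankel determinant). A probability measure $\mu$ on $\mathbb{R}$ is freely infinitely divisible if for every $n\in\mathbb{N}$, $n\ge1$, there is a probability measure $\mu_n$ on $\mathbb{R}$ such that $\mu$ is the $n$-fold free additive convolution power $\mu_n^{\boxplus n}$. *)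

(* Defs.v *)
From HB Require Import structures.
From mathcomp Require Import all_boot all_order all_algebra.
From mathcomp Require Import all_classical all_reals all_analysis.
From mathcomp Require Import measurable_realfun complex ring lra.
Set Implicit Arguments.
Unset Strict Implicit.
Unset Printing Implicit Defensive.
Import Order.TTheory GRing.Theory Num.Theory.
Import numFieldNormedType.Exports.
Local Open Scope classical_set_scope.
Local Open Scope ring_scope.

Section beta.
Context {R : realType}.
Implicit Types p q x : R.
Local Notation leb := (@lebesgue_measure R).

Definition beta_kernel p q x : R := x `^ (p - 1) * (1 - x) `^ (q - 1).

Definition euler_beta p q : R := \int[leb]_(x in `]0, 1[) beta_kernel p q x.

Definition beta_density p q x : R :=
  if (0 < x < 1) then beta_kernel p q x / euler_beta p q else 0.

Definition beta_law p q (A : set (measurableTypeR R)) : \bar R :=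
  (\int[leb]_(x in A) (beta_density p q x)%:E)%E.

Lemma beta_kernel_ge0 p q x : 0 <= beta_kernel p q x.
Proof. by rewrite mulr_ge0 ?powR_ge0. Qed.

Lemma measurable_beta_kernel p q : measurable_fun setT (beta_kernel p q).
Proof.
apply: measurable_funM; first exact: measurable_powR.
apply: (@measurableT_comp _ _ _ _ _ _ (@powR R ^~ (q - 1))) => //.
exact: measurable_funB.
Qed.

Lemma integral01_lty (G g : R -> R) (M : R) :
  (forall x, 0 < x < 1 -> is_derive x 1 G (g x)) ->
  (forall x, 0 < x < 1 -> {for x, continuous g}) ->
  measurable_fun setT g -> (forall x, 0 <= g x) ->
  (forall x, 0 < x < 1 -> `|G x| <= M) ->
  (\int[leb]_(x in `]0%R, 1%R[) (g x)%:E < +oo)%E.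
Proof.
move=> dG cg mg g0 GM.
pose e n : R := n.+3%:R^-1.
have e0 n : 0 < e n by rewrite invr_gt0.
have e1 n : e n < 1 - e n.
  have : e n <= 3^-1 by rewrite lef_pV2 ?posrE// ler_nat.
  by lra.
pose F n : set R := `[e n, 1 - e n]%classic.
have FE : `]0%R, 1%R[%classic = \bigcup_n F n.
  apply/seteqP; split=> [x|x [n _]] /=; last first.
    by rewrite /F/= !in_itv/= => /andP[a b]; have := e0 n; lra.
  rewrite in_itv/= => /andP[x0 x1].
  have mp : 0 < Num.min x (1 - x) by rewrite lt_min x0 subr_gt0.
  exists (Num.bound (Num.min x (1 - x))^-1) => //.
  have : e (Num.bound (Num.min x (1 - x))^-1) <= Num.min x (1 - x).
    rewrite /e -[leRHS]invrK lef_pV2 ?posrE ?invr_gt0//.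
    apply: ltW; apply: (@lt_le_trans _ _ (Num.bound (Num.min x (1 - x))^-1)%:R).
      by rewrite archi_boundP// invr_ge0 ltW.
    by rewrite ler_nat -addn3 leq_addr.
  by rewrite le_min /F/= in_itv/= => /andP[-> ?]; lra.
have nF : nondecreasing_seq F.
  move=> m n mn; rewrite subsetEset /F => x /=; rewrite !in_itv/= => /andP[a b].
  have : e n <= e m by rewrite lef_pV2 ?posrE// ler_nat !ltnS.
  by lra.
have cv : (\int[leb]_(x in F n) (g x)%:E @[n --> \oo] -->
           \int[leb]_(x in \bigcup_i F i) (g x)%:E)%E.
  apply: ge0_nondecreasing_set_cvg_integral => //.
  - by move=> n; exact: measurable_itv.
  - by move=> n; apply: measurable_funTS; exact: measurableT_comp.
  - by move=> n x _; rewrite lee_fin.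
have in01 n x : F n x -> 0 < x < 1.
  by rewrite /F/= in_itv/=; have := e0 n; lra.
apply: (@le_lt_trans _ _ (M + M)%:E); last by rewrite ltry.
rewrite FE; apply: (cvge_le _ cv); apply: nearW => n.
rewrite (@continuous_FTC2 _ g G) => //.
- rewrite -EFinB lee_fin.
  have /GM : 0 < e n < 1 by apply: (in01 n); rewrite /F/= in_itv/= lexx ltW.
  have /GM : 0 < 1 - e n < 1.
    by apply: (in01 n); rewrite /F/= in_itv/= lexx ltW.
  by rewrite !ler_norml; lra.
- by apply: continuous_in_subspaceT => x /set_mem /in01 /cg.
- have cG x : F n x -> {for x, continuous G}.
    move=> /in01 /dG dGx; apply: differentiable_continuous.
    by apply/derivable1_diffP; exact: ex_derive.
  split.
  + move=> x; rewrite inE/= => xe; have /dG dGx : 0 < x < 1.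
      by apply: (in01 n); apply: subset_itv_oo_cc xe.
    exact: ex_derive.
  + by apply: cvg_at_right_filter; apply: cG; rewrite /F/= in_itv/= lexx ltW.
  + by apply: cvg_at_left_filter; apply: cG; rewrite /F/= in_itv/= lexx ltW.
- move=> x xe; have /dG dGx : 0 < x < 1.
    by apply: (in01 n); apply: subset_itv_oo_cc xe.
  by rewrite derive1E derive_val.
Qed.

Lemma powR_half_le (r y : R) : 2^-1 <= y <= 1 ->
  y `^ r <= Num.max 1 (2^-1 `^ r).
Proof.
move=> /andP[y2 y1]; have y0 : 0 < y by apply: lt_le_trans y2; rewrite invr_gt0.
rewrite le_max; have [r0|r0] := leP 0 r.
  have : y `^ r <= 1 `^ r by rewrite ge0_ler_powR ?nnegrE// ltW.
  by rewrite powR1 => ->.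
apply/orP; right; rewrite -(opprK r) !(powRN _ (- r)).
rewrite lef_pV2 ?posrE ?powR_gt0 ?invr_gt0//.
by rewrite ge0_ler_powR ?nnegrE ?oppr_ge0 ?invr_ge0// ltW.
Qed.

Lemma powR_int_lty p : 0 < p ->
  (\int[leb]_(x in `]0%R, 1%R[) (x `^ (p - 1))%:E < +oo)%E.
Proof.
move=> p0.
apply: (@integral01_lty (fun x => p^-1 * x `^ p) _ p^-1) => //.
- move=> x /andP[x0 _].
  have dx := is_derive1_powR p x0.
  have -> : x `^ (p - 1) = p^-1 *: (p * x `^ (p - 1)).
    by rewrite /GRing.scale/= mulKf ?gt_eqF.
  exact: is_deriveZ.
- move=> x /andP[x0 _]; apply: differentiable_continuous.
  by apply/derivable1_diffP; apply: derivable_powR; rewrite in_itv/= x0.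
- by move=> x; exact: powR_ge0.
- move=> x /andP[x0 x1]; rewrite ger0_norm ?mulr_ge0 ?powR_ge0 ?invr_ge0 ?(ltW p0)//.
  rewrite ler_piMr ?invr_ge0 ?(ltW p0)//.
  have : x `^ p <= 1 `^ p by rewrite ge0_ler_powR ?nnegrE// ltW.
  by rewrite powR1.
Qed.

Lemma powR_onem_int_lty q : 0 < q ->
  (\int[leb]_(x in `]0%R, 1%R[) ((1 - x) `^ (q - 1))%:E < +oo)%E.
Proof.
move=> q0.
have dG (r x : R) : 0 < x < 1 ->
    is_derive x 1 (fun x => (1 - x) `^ r) (- (r * (1 - x) `^ (r - 1))).
  move=> /andP[_ x1].
  have x0 : 0 < 1 - x by rewrite subr_gt0.
  have d1 := is_derive1_powR r x0.
  have d2 : is_derive x 1 (fun x : R => 1 - x) (-1).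
    by rewrite -[- 1]add0r; exact: is_deriveB.
  have := @is_derive1_comp _ (fun y => y `^ r) (fun x => 1 - x) x _ _ d1 d2.
  by rewrite mulrN1.
apply: (@integral01_lty (fun x => - q^-1 * (1 - x) `^ q) _ q^-1) => //.
- move=> x x01; have dx := dG q _ x01.
  have -> : (1 - x) `^ (q - 1) = - q^-1 *: - (q * (1 - x) `^ (q - 1)).
    by rewrite /GRing.scale/= mulrNN mulKf ?gt_eqF.
  exact: is_deriveZ.
- move=> x /(dG (q - 1)) dx; apply: differentiable_continuous.
  by apply/derivable1_diffP; exact: ex_derive.
- apply: (@measurableT_comp _ _ _ _ _ _ (@powR R ^~ (q - 1))) => //.
  exact: measurable_funB.
- by move=> x; exact: powR_ge0.
- move=> x /andP[x0 x1]; rewrite mulNr normrN.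
  rewrite ger0_norm ?mulr_ge0 ?powR_ge0 ?invr_ge0 ?(ltW q0)//.
  rewrite ler_piMr ?invr_ge0 ?(ltW q0)//.
  have : (1 - x) `^ q <= 1 `^ q.
    by rewrite ge0_ler_powR ?nnegrE ?subr_ge0 ?gerBl// ltW.
  by rewrite powR1.
Qed.

Lemma beta_kernel_int_lty p q : 0 < p -> 0 < q ->
  (\int[leb]_(x in `]0%R, 1%R[) (beta_kernel p q x)%:E < +oo)%E.
Proof.
move=> p0 q0.
pose C (r : R) : R := Num.max 1 (2^-1 `^ (r - 1)).
have C0 r : 0 <= C r by rewrite le_max ler01.
have mx (r : R) : measurable_fun (`]0%R, 1%R[%classic : set R) (fun x : R => (x `^ r)%:E).
  by apply: measurable_funTS; apply: measurableT_comp => //; exact: measurable_powR.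
have m1x (r : R) : measurable_fun (`]0%R, 1%R[%classic : set R) (fun x : R => ((1 - x) `^ r)%:E).
  apply: measurable_funTS; apply: measurableT_comp => //.
  apply: (@measurableT_comp _ _ _ _ _ _ (@powR R ^~ r)) => //.
  exact: measurable_funB.
apply: (@le_lt_trans _ _ (\int[leb]_(x in `]0%R, 1%R[)
   ((C q)%:E * (x `^ (p - 1))%:E + (C p)%:E * ((1 - x) `^ (q - 1))%:E))%E).
  apply: ge0_le_integral => //=.
  - by move=> x _; rewrite lee_fin beta_kernel_ge0.
  - apply: measurable_funTS; apply: measurableT_comp => //.
    exact: measurable_beta_kernel.
  - by apply: emeasurable_funD; apply: measurable_funeM; [exact: mx|exact: m1x].
  - move=> x; rewrite in_itv/= => /andP[x0 x1].
    rewrite -!EFinM -EFinD lee_fin /beta_kernel.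
    have [x2|x2] := leP x 2^-1.
      rewrite -[leLHS]addr0 lerD//; last by rewrite mulr_ge0 ?powR_ge0.
      rewrite mulrC ler_wpM2r ?powR_ge0// powR_half_le//; lra.
    rewrite -[leLHS]add0r lerD//; first by rewrite mulr_ge0 ?powR_ge0.
    by rewrite ler_wpM2r ?powR_ge0// powR_half_le// !ltW.
rewrite ge0_integralD//=; last 4 first.
- by move=> x _; rewrite -!EFinM lee_fin mulr_ge0 ?powR_ge0.
- by apply: measurable_funeM; exact: mx.
- by move=> x _; rewrite -!EFinM lee_fin mulr_ge0 ?powR_ge0.
- by apply: measurable_funeM; exact: m1x.
rewrite !ge0_integralZl_EFin//.
- by rewrite lte_add_pinfty// lte_mul_pinfty// ?lee_fin// ?powR_int_lty
    ?powR_onem_int_lty.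
- by move=> x _; rewrite lee_fin powR_ge0.
- exact: m1x.
- by move=> x _; rewrite lee_fin powR_ge0.
- exact: mx.
Qed.

Lemma EFin_euler_beta p q : 0 < p -> 0 < q ->
  (\int[leb]_(x in `]0%R, 1%R[) (beta_kernel p q x)%:E = (euler_beta p q)%:E)%E.
Proof.
move=> p0 q0; rewrite /euler_beta /Rintegral fineK// ge0_fin_numE.
  exact: beta_kernel_int_lty.
by apply: integral_ge0 => x _; rewrite lee_fin beta_kernel_ge0.
Qed.

Lemma euler_beta_gt0 p q : 0 < p -> 0 < q -> 0 < euler_beta p q.
Proof.
move=> p0 q0; rewrite lt_neqAle eq_sym; apply/andP; split; last first.
  rewrite /euler_beta /Rintegral fine_ge0//.
  by apply: integral_ge0 => x _; rewrite lee_fin beta_kernel_ge0.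
apply/eqP => B0; have := EFin_euler_beta p0 q0; rewrite B0 => I0.
have mk : measurable_fun (`]0%R, 1%R[%classic : set R) (fun x => (beta_kernel p q x)%:E).
  apply: measurable_funTS; apply: measurableT_comp => //.
  exact: measurable_beta_kernel.
have : ae_eq leb (`]0%R, 1%R[%classic : set R) (fun x => (beta_kernel p q x)%:E) (cst 0%E).
  apply/ae_eq_integral_abs => //; rewrite -[RHS]I0.
  by apply: eq_integral => x _; rewrite gee0_abs// lee_fin beta_kernel_ge0.
move=> [N [mN N0 sub]].
have : (leb (`]0%R, 1%R[%classic : set R) <= leb N)%E.
  apply: le_measure; rewrite ?inE//.
  apply: subset_trans sub => x x01 /= /(_ x01) [].
  move: x01; rewrite /= in_itv/= => /andP[x0 x1]; apply/eqP.
  by rewrite gt_eqF// mulr_gt0// powR_gt0 ?subr_gt0.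
have -> : leb N = 0%E by exact: N0.
rewrite lebesgue_measure_itv/= lte_fin ltr01 oppr0 adde0.
by rewrite lee_fin ler10.
Qed.


Lemma beta_density_ge0 p q x : 0 <= beta_density p q x.
Proof.
rewrite /beta_density; case: ifP => // _.
rewrite divr_ge0 ?beta_kernel_ge0// /euler_beta /Rintegral fine_ge0//.
by apply: integral_ge0 => y _; rewrite lee_fin beta_kernel_ge0.
Qed.

Lemma beta_densityE p q :
  beta_density p q =
  (fun x => (euler_beta p q)^-1 * beta_kernel p q x) \_ `]0, 1[.
Proof.
apply/funext => x; rewrite patchE /beta_density mem_setE in_itv/=.
by case: ifP => // _; rewrite mulrC.
Qed.

Lemma measurable_beta_density p q : measurable_fun setT (beta_density p q).
Proof.
rewrite beta_densityE; apply/measurable_restrict => //; rewrite setTI.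
by apply: measurable_funTS; apply: measurable_funM => //;
  exact: measurable_beta_kernel.
Qed.

Let beta_law0 p q : beta_law p q set0 = 0%E.
Proof. by rewrite /beta_law integral_set0. Qed.

Let beta_law_ge0 p q A : (0 <= beta_law p q A)%E.
Proof.
by apply: integral_ge0 => x _; rewrite lee_fin beta_density_ge0.
Qed.

Let beta_law_sigma_additive p q : semi_sigma_additive (beta_law p q).
Proof.
move=> /= F mF tF mUF; rewrite /beta_law; apply: cvg_toP.
  apply: ereal_nondecreasing_is_cvgn => m n mn.
  apply: lee_sum_nneg_natr => // k _ _; apply: integral_ge0 => /= x Fkx.
  by rewrite lee_fin beta_density_ge0.
rewrite ge0_integral_bigcup//=.
- apply/measurable_funTS/measurableT_comp => //.
  exact: measurable_beta_density.
- by move=> x _; rewrite lee_fin beta_density_ge0.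
Qed.

HB.instance Definition _ p q := isMeasure.Build _ _ _
  (beta_law p q) (beta_law0 p q) (beta_law_ge0 p q)
  (@beta_law_sigma_additive p q).

Lemma beta_law_setT p q : 0 < p -> 0 < q -> beta_law p q setT = 1%E.
Proof.
move=> p0 q0; rewrite /beta_law beta_densityE.
transitivity (\int[leb]_(x in `]0%R, 1%R[)
    ((euler_beta p q)^-1%:E * (beta_kernel p q x)%:E))%E.
  rewrite [RHS]integral_mkcond; apply: eq_integral => x _.
  by rewrite !patchE; case: ifP.
rewrite ge0_integralZl_EFin//=; last 3 first.
- by move=> x _; rewrite lee_fin beta_kernel_ge0.
- apply: measurable_funTS; apply: measurableT_comp => //.
  exact: measurable_beta_kernel.
- by rewrite invr_ge0 ltW ?euler_beta_gt0.
by rewrite EFin_euler_beta// -EFinM mulVf// gt_eqF// euler_beta_gt0.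
Qed.

Definition beta_distribution p q (p0 : 0 < p) (q0 : 0 < q) :
  set (measurableTypeR R) -> \bar R := beta_law p q.

HB.instance Definition _ p q (p0 : 0 < p) (q0 : 0 < q) :=
  Measure.on (beta_distribution p0 q0).

HB.instance Definition _ p q (p0 : 0 < p) (q0 : 0 < q) :=
  @Measure_isProbability.Build _ _ _ (beta_distribution p0 q0)
    (beta_law_setT p0 q0).

End beta.

Section free_cumulants.

(* A partition of {0, ..., n-1} is noncrossing if no two distinct blocks A, B
   admit i < j < k < l with i, k in A and j, l in B. *)
Definition noncrossing (n : nat) (P : {set {set 'I_n}}) : bool :=
  [forall A in P, forall B in P,
   forall i in A, forall j in B, forall k in A, forall l in B,
     [&& (i < j)%N, (j < k)%N & (k < l)%N] ==> (A == B)].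

Definition NC (n : nat) : {set {set {set 'I_n}}} :=
  [set P | finset.partition P [set: 'I_n] & noncrossing P]%SET.

Context {R : realType}.
Implicit Types (m kappa : nat -> R) (mu : probability (measurableTypeR R) R).

Definition moment mu (n : nat) : R := \int[mu]_x x ^+ n.

Definition moment_cumulant m kappa : Prop :=
  forall n, (0 < n)%N ->
    m n = \sum_(P in NC n) \prod_(V in P) kappa #|V|.

(* The sequence determined by the moment-cumulant relations: see
   free_cumulantP and moment_cumulant_uniq. Its value at 0 is irrelevant, since
   blocks are nonempty. *)
Definition free_cumulant mu : nat -> R :=
  xget (fun=> 0) (moment_cumulant (moment mu)).

Lemma NC_top n : [set [set: 'I_n.+1]]%SET \in NC n.+1.
Proof.
rewrite inE; apply/andP; split.
  rewrite /finset.partition /finset.cover big_set1 eqxx finset.trivIset1/= inE eq_sym.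
  by apply/finset.set0Pn; exists ord0; rewrite inE.
apply/forall_inP => A /set1P ->; apply/forall_inP => B /set1P ->.
do 4 (apply/forall_inP => ? _).
by rewrite eqxx implybT.
Qed.

Lemma NC_block_lt n (P : {set {set 'I_n.+1}}) (V : {set 'I_n.+1}) :
  P \in NC n.+1 -> P != [set [set: 'I_n.+1]]%SET -> V \in P -> (0 < #|V| < n.+1)%N.
Proof.
rewrite inE => /andP[partP _] PT VP.
have [/eqP cP tP P0] := and3P partP.
have V0 : V != finset.set0 by apply: contraNneq P0 => <-.
rewrite card_gt0 V0/= -[ltnRHS](card_ord n.+1) -finset.cardsT.
apply: proper_card; rewrite properT; apply: contra PT => /eqP VT.
apply/eqP/setP => W; rewrite inE; apply/idP/eqP => [WP|->]; last by rewrite -VT.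
apply/eqP; rewrite -VT; apply: contraTT isT => WV.
have /finset.set0Pn[x xW] : W != finset.set0 by apply: contraNneq P0 => <-.
have /disjoint_setI0/setP/(_ x) := finset.trivIsetP tP _ _ WP VP WV.
by rewrite !inE xW VT inE.
Qed.

Lemma NC_sum_top n kappa :
  \sum_(P in NC n.+1) \prod_(V in P) kappa #|V| =
  kappa n.+1 + \sum_(P in NC n.+1 | P != [set [set: 'I_n.+1]]%SET)
                 \prod_(V in P) kappa #|V|.
Proof. by rewrite (bigD1 _ (NC_top n))/= big_set1 finset.cardsT card_ord. Qed.

Lemma moment_cumulant_ex m : exists kappa, moment_cumulant m kappa.
Proof.
pose fix c n : nat -> R := if n is n'.+1 then
    fun k => if k == n then m n -
      \sum_(P in NC n | P != [set [set: 'I_n]]%SET) \prod_(V in P) c n' #|V|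
    else c n' k
  else fun=> 0.
have cE n k : (k <= n)%N -> c n k = c k k.
  elim: n => [|n IH]; first by rewrite leqn0 => /eqP ->.
  by rewrite leq_eqVlt => /predU1P[->//|kn] /=; rewrite ltn_eqF// IH.
exists (fun n => c n n) => -[//|n] _.
rewrite (NC_sum_top n (fun k => c k k)) /= eqxx -[LHS](subrK (\sum_(P in NC n.+1 |
  P != [set [set: 'I_n.+1]]%SET) \prod_(V in P) c n #|V|)); congr (_ + _).
apply: eq_bigr => P /andP[PN PT]; apply: eq_bigr => V VP.
by apply: cE; have := NC_block_lt PN PT VP; rewrite ltnS => /andP[].
Qed.

Lemma free_cumulantP mu : moment_cumulant (moment mu) (free_cumulant mu).
Proof.
have [kappa mk] := moment_cumulant_ex (moment mu).
exact: (xgetI (fun=> 0) mk).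
Qed.

Lemma moment_cumulant_uniq m kappa kappa' n :
  moment_cumulant m kappa -> moment_cumulant m kappa' -> (0 < n)%N ->
  kappa n = kappa' n.
Proof.
move=> mk mk'; elim/ltn_ind: n => -[//|n] IH _.
have := mk n.+1 isT; rewrite (mk' n.+1 isT) !NC_sum_top.
rewrite [X in _ = _ + X](eq_bigr (fun P : {set {set 'I_n.+1}} =>
  \prod_(V in P) kappa' #|V|)) => [/addIr //|P /andP[PN PT]].
apply: eq_bigr => V VP.
by have /andP[V0 Vn] := NC_block_lt PN PT VP; exact: IH.
Qed.

Definition D2 mu : R :=
  \det (\matrix_(i < 3, j < 3) free_cumulant mu (i + j + 2)%N).

End free_cumulants.

Section free_convolution.
Context {R : realType}.
Implicit Types (mu nu rho : probability (measurableTypeR R) R).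
Local Open Scope complex_scope.

(* G_mu(z) = \int 1 / (z - x) mu(dx), real and imaginary parts integrated
   separately. *)
Definition cauchy_transform mu (z : R[i]) : R[i] :=
  (\int[mu]_x complex.Re (z - x%:C)^-1) +i*
  (\int[mu]_x complex.Im (z - x%:C)^-1).

Definition reciprocal_cauchy mu (z : R[i]) : R[i] := (cauchy_transform mu z)^-1.

Definition truncated_cone (a b : R) : set R[i] :=
  [set z | b < complex.Im z /\ `|complex.Re z| < a * complex.Im z].

(* phi is, on truncated_cone a b, the Voiculescu transform F_mu^{-1}(z) - z,
   where F_mu^{-1} is the right inverse of F_mu with values in a truncated cone
   on which F_mu is univalent (Bercovici and Voiculescu). Since F_mu(w) ~ w at
   infinity in truncated cones, different choices of this cone give functions
   that agree on some smaller truncated cone. *)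
Definition voiculescu_transform mu (a b : R) (phi : R[i] -> R[i]) : Prop :=
  exists l M : R, [/\ 0 < l, 0 < M,
    set_inj (truncated_cone l M) (reciprocal_cauchy mu) &
    forall z, truncated_cone a b z ->
      truncated_cone l M (z + phi z) /\ reciprocal_cauchy mu (z + phi z) = z].

(* rho is the free additive convolution of mu and nu, for arbitrary (possibly
   unbounded, without moments) laws: the Voiculescu transforms satisfy
   phi_rho = phi_mu + phi_nu on a common domain. *)
Definition free_convolution mu nu rho : Prop :=
  exists (a b : R) (phi psi : R[i] -> R[i]), [/\ 0 < a, 0 < b,
    voiculescu_transform mu a b phi,
    voiculescu_transform nu a b psi &
    voiculescu_transform rho a b (phi \+ psi)].

(* free_power mu n rho: rho is the n-fold free additive convolution power of
   mu, n >= 1. *)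
Inductive free_power mu : nat -> probability (measurableTypeR R) R -> Prop :=
| free_power1 : free_power mu 1 mu
| free_powerS n nu rho : free_power mu n nu -> free_convolution nu mu rho ->
    free_power mu n.+1 rho.

Definition freely_infinitely_divisible mu : Prop :=
  forall n, (1 <= n)%N ->
    exists mu_n : probability (measurableTypeR R) R, free_power mu_n n mu.

End free_convolution.

Section P2.
Context {R : realType}.
Implicit Types s u : R.

(* Ring numerals are unary, so that coefficients above 5000 are split as
   a * 1000 + b. *)
Definition A0 s : R := 24 * s ^+ 2 * (s + 1) ^+ 4 * (s + 2).

Definition A1 s : R := 8 * s * (s + 1) ^+ 2 *
  (4 * s ^+ 5 - 17 * s ^+ 4 - 139 * s ^+ 3 - 292 * s ^+ 2 - 318 * s - 216).

Definition A2 s : R := 4 * s * (s + 1) *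
  (3 * s ^+ 7 - 49 * s ^+ 6 - 125 * s ^+ 5 + 663 * s ^+ 4 + 3812 * s ^+ 3
   + (9 * 1000 + 4) * s ^+ 2 + (11 * 1000 + 472) * s + (5 * 1000 + 760)).

Definition A3 s : R :=
  3 * s ^+ 10 - 18 * s ^+ 9 + 260 * s ^+ 8 + 1866 * s ^+ 7 + 1993 * s ^+ 6
  - (16 * 1000 + 432) * s ^+ 5 - (81 * 1000 + 624) * s ^+ 4
  - (180 * 1000 + 416) * s ^+ 3 - (210 * 1000 + 672) * s ^+ 2
  - (127 * 1000 + 872) * s - (34 * 1000 + 560).

Definition P2 s u : R := A0 s + u * A1 s + u ^+ 2 * A2 s + u ^+ 3 * A3 s.

End P2.

(* Main.v *)
Require Import Defs.
From mathcomp Require Import all_boot all_order all_algebra.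
From mathcomp Require Import all_classical all_reals all_analysis.
From mathcomp Require Import measurable_realfun complex ring lra.
Set Implicit Arguments.
Unset Strict Implicit.
Unset Printing Implicit Defensive.
Import Order.TTheory GRing.Theory Num.Theory.
Import numFieldNormedType.Exports.
Local Open Scope classical_set_scope.
Local Open Scope ring_scope.

(* The determinant is computed from the moments of the beta law, which satisfy
   m_(n+1) = (p + n) / (p + q + n) m_n, and from the moment-cumulant relations up
   to order six.

   If mu is compactly supported and is the n-fold free power of nu, then
   phi_mu = n phi_nu for the Voiculescu transforms, and with F_nu the reciprocal
   Cauchy transform and w_i = z_i + phi_nu(z_i), so that F_nu(w_i) = z_i, the
   matrix with entries (z_i - conj z_j) / (w_i - conj w_j) - 1 is positive
   semidefinite: it is the Gram matrix of the functions F_nu(w_i) / (w_i - x) - 1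
   in L^2(nu). No moment of nu is involved. At infinity phi_mu(z) is the sum of
   the kappa_(k+1)(mu) z^(-k), k < 6, up to O(z^(-6)), so letting three points
   z_i go to infinity along the imaginary axis, and then n, shows that the Hankel
   matrix of the kappa_(i+j+2), i, j < 3, is positive semidefinite. *)

(** * Free cumulants up to order six *)

(** The obstacle is that an $n$-th free root [nu] comes only with a Voiculescu transform on some
    truncated cone, so the usual limit of $n\,m_k(\nu)$ is not at hand. The Pick kernel works
    because $\varphi_\nu$ can be eliminated from it: with $A$ the difference quotient of
    $-\varphi_\mu$ at $z_i$ and $\overline{z_j}$, $n$ times the kernel is
    $A/(1-A/n)=A+A^2/n+A^3/n^2+\dots$, which depends on $\mu$ and $n$ alone. In the variables
    $x=1/z_i$, $y=1/\overline{z_j}$ the expansion of $A$ is $\sum\kappa_{k+l+2}x^{k+1}y^{l+1}$. With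
    three points of size $1/e$, isolating the coefficients with $k,l<3$ takes weights of size
    $e^{-3}$; these multiply errors by $e^{-6}$, so the kernel must be known up to $O(e^7)$. This
    dictates the precision $O(e^6)$ for $\varphi_\mu$ and, since $A=O(e^2)$, the three terms kept of
    the geometric series. The terms in $1/n$ and $1/n^2$ carry forms bounded independently of $n$,
    which permits $e\to0$ for each fixed $n$ before $n\to\infty$. *)

Section enumeration.
Local Open Scope nat_scope.

(* A partition is encoded by the sequence sending each element to the least element
   of its block; labelings n lists the sequences s of size n with s_i <= i. *)
Fixpoint labelings (n : nat) : seq (seq nat) :=
  if n is n'.+1 then [seq rcons s k | s <- labelings n', k <- iota 0 n] else [:: [::]].

(** A label that is its own label and is at most $i$ is the least element of the class of $i$: any
    $j$ in that class has the same label, which is at most $j$. *)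
Definition min_labeling (n : nat) (s : seq nat) : bool :=
  all (fun i => (nth 0 s (nth 0 s i) == nth 0 s i) && (nth 0 s i <= i)) (iota 0 n).

Definition nc_labeling (n : nat) (s : seq nat) : bool :=
  all (fun i => all (fun j => all (fun k => all (fun l =>
    [&& i < j, j < k, k < l, nth 0 s i == nth 0 s k & nth 0 s j == nth 0 s l] ==>
    (nth 0 s i == nth 0 s j)) (iota 0 n)) (iota 0 n)) (iota 0 n)) (iota 0 n).

Definition block_sizes (n : nat) (s : seq nat) : seq nat :=
  [seq count_mem i s | i <- iota 0 n & nth 0 s i == i].

Definition nc_types (n : nat) : seq (seq nat) :=
  [seq block_sizes n s | s <- labelings n & min_labeling n s && nc_labeling n s].

Lemma labelingsP n s :
  (s \in labelings n) = (size s == n) && all (fun i => nth 0 s i <= i) (iota 0 n).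
Proof.
elim: n s => [|n IH] s; first by rewrite inE /= andbT size_eq0.
apply/allpairsP/andP => [[[t k] [tL kn ->]]|[/eqP sn /allP sP]].
  have {}kn : k \in iota 0 n.+1 := kn; have {tL} : t \in labelings n := tL.
  rewrite [rcons _ _]/(rcons t k) IH => /andP[/eqP tn /allP tP]; rewrite size_rcons tn eqxx; split; first by [].
  apply/allP => i; rewrite mem_iota add0n /= ltnS leq_eqVlt => /predU1P[->|iN].
    by rewrite nth_rcons tn ltnn eqxx; move: kn; rewrite mem_iota.
  by rewrite nth_rcons tn iN; apply: tP; rewrite mem_iota.
case/lastP: s sn sP => // t k; rewrite size_rcons => -[tn] sP.
have tP i : i < n.+1 -> nth 0 (rcons t k) i <= i.
  by move=> iN; apply: sP; rewrite mem_iota.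
have kn : k < n.+1.
  by have := tP n (ltnSn n); rewrite nth_rcons tn ltnn eqxx ltnS.
exists (t, k); split; [|by rewrite mem_iota|by []].
rewrite IH tn eqxx; apply/allP => i; rewrite mem_iota /= add0n => iN.
by have := tP i (ltnW iN); rewrite nth_rcons tn iN.
Qed.

Lemma labelings_uniq n : uniq (labelings n).
Proof.
elim: n => // n IH; apply: allpairs_uniq => //; first exact: iota_uniq.
by move=> [s k] [t l] _ _ /= /rcons_inj [-> ->].
Qed.

Definition labeling_of (n : nat) (f : {ffun 'I_n -> 'I_n}) : seq nat :=
  [seq val (f i) | i <- enum 'I_n].

Lemma size_labeling n (f : {ffun 'I_n -> 'I_n}) : size (labeling_of f) = n.
Proof. by rewrite size_map size_enum_ord. Qed.

Lemma nth_labeling n (f : {ffun 'I_n -> 'I_n}) (i : 'I_n) : nth 0 (labeling_of f) i = f i.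
Proof. by rewrite (nth_map i) ?size_enum_ord// nth_ord_enum. Qed.

Lemma labeling_inj n : injective (@labeling_of n).
Proof.
move=> f g fg; apply/ffunP => i; apply/val_inj; rewrite /=.
by rewrite -(nth_labeling f) fg nth_labeling.
Qed.

Lemma all_iota_ord n (P : pred nat) : all P (iota 0 n) = [forall i : 'I_n, P i].
Proof.
apply/allP/forallP => [h i|h i]; first by apply: h; rewrite mem_iota ltn_ord.
by rewrite mem_iota /= add0n => iN; exact: (h (Ordinal iN)).
Qed.

Lemma count_labeling n (f : {ffun 'I_n -> 'I_n}) (i : 'I_n) :
  count_mem (val i) (labeling_of f) = #|[set j | f j == i]%SET|.
Proof.
rewrite count_map -sum1dep_card -sum1_count big_enum_cond /=.
by apply: eq_bigl => j; rewrite ?inE.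
Qed.

Definition block_min (n : nat) (P : {set {set 'I_n}}) : {ffun 'I_n -> 'I_n} :=
  [ffun i => [arg min_(j < i in finset.pblock P i) val j]].

Definition label_partition (n : nat) (f : {ffun 'I_n -> 'I_n}) : {set {set 'I_n}} :=
  finset.preim_partition f [set: 'I_n].

Lemma label_partitionP n (f : {ffun 'I_n -> 'I_n}) :
  finset.partition (label_partition f) [set: 'I_n].
Proof. exact: finset.preim_partitionP. Qed.

Lemma pblock_label n (f : {ffun 'I_n -> 'I_n}) i j :
  (j \in finset.pblock (label_partition f) i) = (f i == f j).
Proof.
rewrite /label_partition /finset.preim_partition finset.pblock_equivalence_partition ?inE//.
by split=> // /eqP ->.
Qed.

Section blocks.
Variables (n : nat) (P : {set {set 'I_n}}).
Hypothesis partP : finset.partition P [set: 'I_n].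

Let tP : finset.trivIset P. Proof. by have [] := and3P partP. Qed.

Let cP i : i \in finset.cover P.
Proof. by have [/eqP -> _ _] := and3P partP; rewrite inE. Qed.

Lemma block_minP i : block_min P i \in finset.pblock P i /\
  forall j, j \in finset.pblock P i -> block_min P i <= j.
Proof.
rewrite ffunE; case: arg_minnP => [|j jP jm]; first by rewrite finset.mem_pblock.
by split.
Qed.

Lemma block_min_eq i j : (block_min P i == block_min P j) = (j \in finset.pblock P i).
Proof.
apply/eqP/idP => [e|ji].
  have [mi _] := block_minP i; have [mj _] := block_minP j.
  rewrite -finset.eq_pblock// -(finset.same_pblock tP mi) e.
  by rewrite (finset.same_pblock tP mj).
have pij : finset.pblock P j = finset.pblock P i by exact: finset.same_pblock.
have [mi li] := block_minP i; have [mj lj] := block_minP j.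
apply/val_inj/eqP; rewrite /= eqn_leq li ?lj ?pij//.
by rewrite -pij.
Qed.

(** One half of the bijection between partitions and minimal labelings; [min_labeling_of] identifies
    the labelings for which the other composite is the identity. *)
Lemma block_minK : label_partition (block_min P) = P.
Proof.
rewrite -[RHS](finset.preim_partition_pblock partP) /label_partition.
rewrite /finset.preim_partition /finset.equivalence_partition.
apply: finset.eq_imset => i; apply/setP => j; rewrite !inE /=.
by rewrite block_min_eq finset.eq_pblock.
Qed.

End blocks.

Lemma min_labeling_of n (f : {ffun 'I_n -> 'I_n}) :
  min_labeling n (labeling_of f) = (block_min (label_partition f) == f).
Proof.
rewrite /min_labeling all_iota_ord.
have minP := block_minP (label_partitionP f).
apply/forallP/eqP => [h|<- i].
  apply/ffunP => i; apply/val_inj/eqP; rewrite /= eqn_leq.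
  have [+ le] := minP i; rewrite pblock_label => /eqP fi.
  apply/andP; split.
    apply: le; rewrite pblock_label.
    by have /andP[+ _] := h i; rewrite !nth_labeling eq_sym.
  by have /andP[_] := h (block_min (label_partition f) i); rewrite !nth_labeling -fi.
rewrite !nth_labeling; set g := block_min _; rewrite -/g.
have [gi le] := minP i; apply/andP; split; last first.
  by apply: le; rewrite pblock_label.
rewrite (_ : _ == _ = (g (g i) == g i))// eq_sym.
by rewrite /g (block_min_eq (label_partitionP f)).
Qed.

Lemma nc_labeling_of n (f : {ffun 'I_n -> 'I_n}) :
  nc_labeling n (labeling_of f) = noncrossing (label_partition f).
Proof.
have partP := label_partitionP f; have [/eqP cP tP _] := and3P partP.
rewrite /nc_labeling all_iota_ord; apply/idP/idP.
  move=> /forallP h; apply/forall_inP => A AP; apply/forall_inP => B BP.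
  apply/forall_inP => i iA; apply/forall_inP => j jB.
  apply/forall_inP => k kA; apply/forall_inP => l lB.
  apply/implyP => /and3P[ij jk kl].
  have := h i; rewrite all_iota_ord => /forallP /(_ j).
  rewrite all_iota_ord => /forallP /(_ k); rewrite all_iota_ord => /forallP /(_ l).
  rewrite ij jk kl /= !nth_labeling => /implyP.
  have eqL x y C : C \in label_partition f -> x \in C -> y \in C -> f x = f y.
    by move=> CP xC yC; apply/eqP; rewrite -pblock_label (finset.def_pblock tP CP xC).
  rewrite (eqL i k A)// (eqL j l B)// !eqxx => /(_ isT) /eqP e.
  have {}e : f k == f l by apply/eqP/val_inj.
  rewrite -(finset.def_pblock tP AP kA) -(finset.def_pblock tP BP lB).
  by rewrite finset.eq_pblock// ?cP ?inE// pblock_label.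
move=> h; apply/forallP => i; rewrite all_iota_ord; apply/forallP => j.
rewrite all_iota_ord; apply/forallP => k; rewrite all_iota_ord; apply/forallP => l.
apply/implyP => /and5P[ij jk kl]; rewrite !nth_labeling => /eqP/val_inj ik /eqP/val_inj jl.
have pm x : finset.pblock (label_partition f) x \in label_partition f.
  by rewrite finset.pblock_mem// cP inE.
have := forall_inP h _ (pm i) => /forall_inP /(_ _ (pm j)) /forall_inP /(_ i).
rewrite pblock_label => /(_ (eqxx _)) /forall_inP /(_ j).
rewrite pblock_label => /(_ (eqxx _)) /forall_inP /(_ k).
rewrite pblock_label ik => /(_ (eqxx _)) /forall_inP /(_ l).
rewrite pblock_label jl => /(_ (eqxx _)); rewrite ij jk kl /= => /eqP e.
have : j \in finset.pblock (label_partition f) i by rewrite e pblock_label.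
by rewrite pblock_label ik jl => /eqP ->.
Qed.
End enumeration.

(** A minimal labeling is idempotent, so its fixed points index the blocks without repetition, and
    the block of a fixed point is its fibre. *)
Lemma label_partition_prod (R : comNzRingType) (kappa : nat -> R) n (f : {ffun 'I_n -> 'I_n}) :
  block_min (label_partition f) = f ->
  \prod_(V in label_partition f) kappa #|V| =
  \prod_(k <- block_sizes n (labeling_of f)) kappa k.
Proof.
move=> fm; have fK i : f (f i) = f i.
  have := min_labeling_of f; rewrite fm eqxx /min_labeling all_iota_ord.
  by move=> /forallP /(_ i) /andP[/eqP + _]; rewrite !nth_labeling => /val_inj.
have -> : label_partition f =
    [set [set j | f j == i] | i in [set i : 'I_n | f i == i]]%SET.
  apply/setP => V; apply/finset.imsetP/finset.imsetP => -[i iR ->].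
    by exists (f i); [rewrite inE fK|apply/setP => j; rewrite !inE eq_sym].
  exists i; first by rewrite inE.
  by apply/setP => j; move: iR; rewrite !inE => /eqP ->; rewrite eq_sym.
rewrite big_imset/=; last first.
  move=> i j; rewrite !inE => /eqP fi /eqP fj /setP/(_ i).
  by rewrite !inE fi eqxx => /esym /eqP.
rewrite /block_sizes big_map big_filter -[n in iota 0 n](subn0) -/(index_iota 0 n).
rewrite big_mkord; apply: eq_big => [i|i]; rewrite ?inE.
  by rewrite nth_labeling.
by rewrite count_labeling.
Qed.

(** Trades the sum over sets of sets, which does not evaluate, for a sum over a list that does. *)
Lemma NC_sum (R : comNzRingType) (kappa : nat -> R) n :
  \sum_(P in NC n) \prod_(V in P) kappa #|V| =
  \sum_(t <- nc_types n) \prod_(k <- t) kappa k.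
Proof.
rewrite (reindex_onto (@label_partition n) (@block_min n)) => [|P]; last first.
  by rewrite inE => /andP[pP _]; exact: block_minK.
rewrite /nc_types big_map.
rewrite [RHS](perm_big [seq labeling_of f | f <- enum {: {ffun 'I_n -> 'I_n}} &
    (label_partition f \in NC n) && (block_min (label_partition f) == f)])/=; last first.
  rewrite perm_sym; apply: uniq_perm.
  - by rewrite (map_inj_uniq (@labeling_inj n)) filter_uniq ?enum_uniq.
  - by rewrite filter_uniq ?labelings_uniq.
  move=> s; rewrite mem_filter labelingsP.
  apply/mapP/andP => [[f]|[/andP[ms ns] /andP[/eqP sn /allP sP]]].
    rewrite mem_filter inE => /andP[/andP[/andP[_ fn] fm] _] ->.
    rewrite min_labeling_of fm nc_labeling_of fn size_labeling eqxx; split=> //.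
    have := min_labeling_of f; rewrite fm /min_labeling => /allP h.
    by apply/allP => i /h /andP[].
  (* The empty case is separate because [inord], used below to turn labels into ordinals, lands in
     ['I_n.+1]. *)
  case: n sn sP ms ns => [|n] sn sP ms ns.
    exists [ffun i => i]; last by move/size0nil: sn => ->; rewrite /labeling_of enum_ord0.
    rewrite mem_filter mem_enum andbT inE label_partitionP -nc_labeling_of -min_labeling_of.
    by rewrite /min_labeling /nc_labeling.
  pose f : {ffun 'I_n.+1 -> 'I_n.+1} := [ffun i : 'I_n.+1 => inord (nth 0%N s i)].
  have fs : labeling_of f = s.
    apply: (@eq_from_nth _ 0%N); first by rewrite size_labeling sn.
    move=> i; rewrite size_labeling => iN; rewrite (nth_labeling f (Ordinal iN)) ffunE/= inordK//.
    by apply: leq_ltn_trans (iN); apply: sP; rewrite mem_iota.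
  exists f => //; rewrite mem_filter mem_enum andbT inE label_partitionP.
  by rewrite -nc_labeling_of -min_labeling_of fs ms ns.
rewrite big_map big_filter big_enum_cond/=; apply: eq_bigr => f /andP[_ /eqP fm].
exact: label_partition_prod.
Qed.

Lemma moment_cumulant6 (R : realType) (m kappa : nat -> R) :
  moment_cumulant m kappa ->
  let k1 := kappa 1%N in let k2 := kappa 2%N in let k3 := kappa 3%N in
  let k4 := kappa 4%N in let k5 := kappa 5%N in let k6 := kappa 6%N in
  [/\ m 1%N = k1,
      m 2%N = k2 + k1 ^+ 2,
      m 3%N = k3 + 3 * k2 * k1 + k1 ^+ 3,
      m 4%N = k4 + 4 * k3 * k1 + 2 * k2 ^+ 2 + 6 * k2 * k1 ^+ 2 + k1 ^+ 4 &
      m 5%N = k5 + 5 * k4 * k1 + 5 * k3 * k2 + 10 * k3 * k1 ^+ 2 + 10 * k2 ^+ 2 * k1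
              + 10 * k2 * k1 ^+ 3 + k1 ^+ 5 /\
      m 6%N = k6 + 6 * k5 * k1 + 6 * k4 * k2 + 3 * k3 ^+ 2 + 15 * k4 * k1 ^+ 2
              + 30 * k3 * k2 * k1 + 5 * k2 ^+ 3 + 20 * k3 * k1 ^+ 3
              + 30 * k2 ^+ 2 * k1 ^+ 2 + 15 * k2 * k1 ^+ 4 + k1 ^+ 6].
Proof.
move=> mk k1 k2 k3 k4 k5 k6.
have mE n : (0 < n)%N -> m n = \sum_(t <- nc_types n) \prod_(k <- t) kappa k.
  by move=> /mk ->; exact: NC_sum.
(* The big operators are replaced by folds, which reduce to polynomial expressions once the list is
   explicit. *)
pose S (l : seq (seq nat)) := foldr (fun t x => foldr (fun k y => kappa k * y) 1 t + x) 0 l.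
have {}mE n : (0 < n)%N -> m n = S (nc_types n).
  move=> /mE ->; rewrite /S; elim: (nc_types n) => [|t l IH]; first by rewrite big_nil.
  rewrite big_cons IH; congr (_ + _).
  by elim: t => [|k t IHt]; rewrite ?big_nil// big_cons IHt.
(* The enumeration is evaluated by the virtual machine, up to the 132 noncrossing partitions of six
   points. *)
have compute n l : nc_types n = l -> (0 < n)%N -> m n = S l by move=> <-; exact: mE.
rewrite (compute 1%N _ (ltac:(vm_compute; reflexivity)))//.
rewrite (compute 2%N _ (ltac:(vm_compute; reflexivity)))//.
rewrite (compute 3%N _ (ltac:(vm_compute; reflexivity)))//.
rewrite (compute 4%N _ (ltac:(vm_compute; reflexivity)))//.
rewrite (compute 5%N _ (ltac:(vm_compute; reflexivity)))//.
rewrite (compute 6%N _ (ltac:(vm_compute; reflexivity)))//.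
rewrite /S /foldr -/k1 -/k2 -/k3 -/k4 -/k5 -/k6.
split; [ring|ring|ring|ring|split; ring].
Qed.

(** * Moments of the beta distribution *)

Section beta_moments.
Context {R : realType}.
Implicit Types p q x : R.
Local Notation leb := (@lebesgue_measure R).

Lemma powRB1K x r : 0 < x -> x `^ r = x * x `^ (r - 1).
Proof.
move=> x0; have {1}-> : r = r - 1 + 1 by rewrite subrK.
rewrite powRD; last by apply/implyP => _; rewrite gt_eqF.
by rewrite powRr1 ?ltW// mulrC.
Qed.

Lemma beta_kernelSl p q x : 0 < x < 1 -> beta_kernel (p + 1) q x = x * beta_kernel p q x.
Proof.
by move=> /andP[x0 x1]; rewrite /beta_kernel addrK mulrA -powRB1K.
Qed.

Lemma beta_kernelSr p q x : 0 < x < 1 -> beta_kernel p (q + 1) x = (1 - x) * beta_kernel p q x.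
Proof.
by move=> /andP[x0 x1]; rewrite /beta_kernel addrK mulrCA -powRB1K ?subr_gt0.
Qed.

(** This is $x+(1-x)=1$ under the integral sign. *)
Lemma euler_betaD p q : 0 < p -> 0 < q ->
  euler_beta (p + 1) q + euler_beta p (q + 1) = euler_beta p q.
Proof.
move=> p0 q0; apply: EFin_inj; rewrite EFinD.
rewrite -!EFin_euler_beta ?addr_gt0// -ge0_integralD//=.
- apply: eq_integral => x; rewrite inE/= in_itv/= => x01.
  by rewrite -EFinD beta_kernelSl// beta_kernelSr//; congr EFin; ring.
- by move=> x _; rewrite lee_fin beta_kernel_ge0.
- by apply: measurable_funTS; apply: measurableT_comp => //; exact: measurable_beta_kernel.
- by move=> x _; rewrite lee_fin beta_kernel_ge0.
- by apply: measurable_funTS; apply: measurableT_comp => //; exact: measurable_beta_kernel.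
Qed.

Lemma is_derive_beta_kernel p q x : 0 < x < 1 ->
  is_derive x 1 (beta_kernel (p + 1) (q + 1))
    (p * beta_kernel p (q + 1) x - q * beta_kernel (p + 1) q x).
Proof.
move=> x01; have /andP[x0 x1] := x01.
have y0 : 0 < 1 - x by rewrite subr_gt0.
have d1 := is_derive1_powR p x0.
have d2 : is_derive x 1 (fun x : R => 1 - x) (-1).
  by rewrite -[- 1]add0r; exact: is_deriveB.
have d3 := is_derive1_powR q y0.
have d4 := @is_derive1_comp _ (fun y => y `^ q) (fun x => 1 - x) x _ _ d3 d2.
have := @is_deriveM _ _ (fun x => x `^ p) _ x 1 _ _ d1 d4.
rewrite /beta_kernel !addrK; congr is_derive.
by rewrite /GRing.scale/=; ring.
Qed.

(** The kernels may be unbounded at both endpoints, so integration by parts is done on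
    $[e_n,1-e_n]$. The shift by three gives $e_n\le1/3$, hence a nondegenerate interval for every
    $n$. *)
Let e n : R := n.+3%:R^-1.

Let e_gt0 n : 0 < e n. Proof. by rewrite invr_gt0. Qed.

Let e_lt n : e n < 1 - e n.
Proof.
have : e n <= 3^-1 by rewrite lef_pV2 ?posrE// ler_nat.
by lra.
Qed.

Let F n : set R := `[e n, 1 - e n]%classic.

Let F01 n x : F n x -> 0 < x < 1.
Proof. by rewrite /F/= in_itv/=; have := e_gt0 n; lra. Qed.

Let bigcupF : `]0%R, 1%R[%classic = \bigcup_n F n.
Proof.
apply/seteqP; split=> [x|x [n _] /F01] /=; last by rewrite in_itv.
rewrite in_itv/= => /andP[x0 x1].
have mp : 0 < Num.min x (1 - x) by rewrite lt_min x0 subr_gt0.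
exists (Num.bound (Num.min x (1 - x))^-1) => //.
have : e (Num.bound (Num.min x (1 - x))^-1) <= Num.min x (1 - x).
  rewrite /e -[leRHS]invrK lef_pV2 ?posrE ?invr_gt0//.
  apply: ltW; apply: (@lt_le_trans _ _ (Num.bound (Num.min x (1 - x))^-1)%:R).
    by rewrite archi_boundP// invr_ge0 ltW.
  by rewrite ler_nat -addn3 leq_addr.
by rewrite le_min /F/= in_itv/= => /andP[-> ?]; lra.
Qed.

Let cvg_beta_kernel p q : 0 < p -> 0 < q ->
  (\int[leb]_(x in F n) beta_kernel p q x)%R @[n --> \oo] --> euler_beta p q.
Proof.
move=> p0 q0; apply: (@fine_cvg _ _ _ _ (fun n => \int[leb]_(x in F n) (beta_kernel p q x)%:E)%E).
rewrite -EFin_euler_beta// bigcupF.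
apply: ge0_nondecreasing_set_cvg_integral => //.
- move=> m n mn; rewrite subsetEset /F => x /=; rewrite !in_itv/= => /andP[a b].
  have : e n <= e m by rewrite lef_pV2 ?posrE// ler_nat !ltnS.
  by lra.
- by move=> n; rewrite /F; apply: measurable_itv.
- move=> n; apply: measurable_funTS; apply: measurableT_comp => //.
  exact: measurable_beta_kernel.
- by move=> n x _; rewrite lee_fin beta_kernel_ge0.
Qed.

(** The boundary terms of the integration by parts: at either endpoint $x^p(1-x)^q\le
    e_n^p+e_n^q$. *)
Let beta_kernel_cvg0 p q (u : nat -> R) : 0 < p -> 0 < q ->
  (forall n, u n = e n \/ u n = 1 - e n) ->
  beta_kernel (p + 1) (q + 1) (u n) @[n --> \oo] --> (0 : R).
Proof.
move=> p0 q0 ue.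
have e0 r : 0 < r -> e n `^ r @[n --> \oo] --> (0 : R).
  move=> r0; have /cvg_at_rightP := powR_cvg0 r0; apply; split=> //.
  rewrite (_ : e = fun n => harmonic (n + 2)%N); last by apply/funext => n; rewrite /e/= addn2.
  by rewrite (cvg_shiftn 2 (harmonic : nat -> R^o)); exact: cvg_harmonic.
apply: (@squeeze_cvgr _ _ _ _ (cst 0) (fun n => e n `^ p + e n `^ q)).
- apply: nearW => n; rewrite beta_kernel_ge0 /= /beta_kernel !addrK.
  have le1 x r : 0 < r -> 0 <= x -> x <= 1 -> x `^ r <= 1.
    move=> r0 x0 x1; have : x `^ r <= 1 `^ r by rewrite ge0_ler_powR ?nnegrE// ltW.
    by rewrite powR1.
  have := e_gt0 n; have := e_lt n => en1 en0.
  have [->|->] := ue n.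
    rewrite -[leLHS]addr0 lerD ?powR_ge0// ler_piMr ?powR_ge0 ?le1//; lra.
  rewrite subKr -[leLHS]add0r lerD ?powR_ge0// ler_piMl ?powR_ge0 ?le1//; lra.
- exact: cvg_cst.
- by rewrite -[0]addr0; apply: cvgD; exact: e0.
Qed.

(** The difference of the two sides is the integral of the derivative of $x^p(1-x)^q$, whose
    boundary values are zero. *)
Lemma euler_beta_sym p q : 0 < p -> 0 < q ->
  p * euler_beta p (q + 1) = q * euler_beta (p + 1) q.
Proof.
move=> p0 q0; have p10 : 0 < p + 1 by lra. have q10 : 0 < q + 1 by lra.
pose K := beta_kernel (p + 1) (q + 1).
pose g x := p * beta_kernel p (q + 1) x - q * beta_kernel (p + 1) q x.
have dK x : 0 < x < 1 -> is_derive x 1 K (g x) by exact: is_derive_beta_kernel.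
have cb r s x : 0 < x < 1 -> {for x, continuous (beta_kernel r s)}.
  move=> /(is_derive_beta_kernel (r - 1) (s - 1)); rewrite !subrK => dx.
  apply: differentiable_continuous; apply/derivable1_diffP; exact: ex_derive.
have cF r s n : {within F n, continuous (beta_kernel r s)}.
  by apply: continuous_in_subspaceT => x /set_mem /F01; exact: cb.
have iF r s n : leb.-integrable (F n) (EFin \o beta_kernel r s).
  apply: continuous_compact_integrable => //; exact: segment_compact.
have E n : p * \int[leb]_(x in F n) beta_kernel p (q + 1) x -
           q * \int[leb]_(x in F n) beta_kernel (p + 1) q x = K (1 - e n) - K (e n).
  have cK x : F n x -> {for x, continuous K} by move=> /F01; exact: cb.
  have Z (r : R) k : leb.-integrable (F n) (EFin \o k) ->
      leb.-integrable (F n) (EFin \o (fun x => r * k x)).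
    move=> ik; have mF : measurable (F n : set (measurableTypeR R)).
      by rewrite /F; apply: measurable_itv.
    by have := integrableZl mF r ik.
  have mF : measurable (F n : set (measurableTypeR R)) by rewrite /F; apply: measurable_itv.
  have E1 := RintegralZl p mF (iF p (q + 1) n).
  have E2 := RintegralZl q mF (iF (p + 1) q n).
  have E3 := RintegralB mF (Z p _ (iF p (q + 1) n)) (Z q _ (iF (p + 1) q n)).
  rewrite E1 E2 in E3; apply: etrans (esym E3) _.
  rewrite /Rintegral (@continuous_FTC2 _ g K) => //.
  - apply: continuous_in_subspaceT => x /set_mem /F01 x01.
    by apply: cvgB; apply: cvgM; [exact: cvg_cst|exact: cb|exact: cvg_cst|exact: cb].
  - split.
    + move=> x; rewrite inE/= => xe; have /dK dKx : 0 < x < 1.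
        by apply: (F01 (n := n)); apply: subset_itv_oo_cc xe.
      exact: ex_derive.
    + by apply: cvg_at_right_filter; apply: cK; rewrite /F/= in_itv/= lexx ltW.
    + by apply: cvg_at_left_filter; apply: cK; rewrite /F/= in_itv/= lexx ltW.
  - move=> x xe; have /dK dKx : 0 < x < 1.
      by apply: (F01 (n := n)); apply: subset_itv_oo_cc xe.
    by rewrite derive1E derive_val.
apply/eqP; rewrite -subr_eq0; apply/eqP.
apply: (@cvg_unique _ _ ((fun n => K (1 - e n) - K (e n)) @ \oo)) => //.
  rewrite -(funext E); apply: cvgB; apply: cvgMr; exact: cvg_beta_kernel.
rewrite -[0]subr0; apply: cvgB; apply: beta_kernel_cvg0 => // n; [by right|by left].
Qed.

(** Solves the linear system that [euler_betaD] and [euler_beta_sym] form in $B(p+1,q)$ and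
    $B(p,q+1)$. *)
Lemma euler_betaSl p q : 0 < p -> 0 < q ->
  euler_beta (p + 1) q = p / (p + q) * euler_beta p q.
Proof.
move=> p0 q0; have s0 : p + q != 0 by rewrite gt_eqF ?addr_gt0.
rewrite -(euler_betaD p0 q0) -[LHS](mulfK s0) [RHS]mulrAC; congr (_ / _).
have := euler_beta_sym p0 q0.
generalize (euler_beta (p + 1) q) (euler_beta p (q + 1)) => a b h.
by rewrite [RHS]mulrDr h mulrDr mulrC [X in _ + X]mulrC.
Qed.

End beta_moments.

(** * The Pick kernel of a reciprocal Cauchy transform *)

Section complex_integral.
Context {R : realType} (mu : probability (measurableTypeR R) R).
Local Open Scope complex_scope.
Implicit Types (f g : R -> R[i]) (w : R[i]).

Local Notation cj := (@conjc R).

Lemma cjV (z : R[i]) : cj z^-1 = (cj z)^-1.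
Proof. exact: conjc_inv. Qed.

Lemma cjB (y z : R[i]) : cj (y - z) = cj y - cj z.
Proof. exact: (rmorphB (@conjc R)). Qed.

Lemma cjM (y z : R[i]) : cj (y * z) = cj y * cj z.
Proof. exact: (rmorphM (@conjc R)). Qed.

Definition cintegrable f : Prop :=
  mu.-integrable setT (EFin \o (fun x => complex.Re (f x))) /\
  mu.-integrable setT (EFin \o (fun x => complex.Im (f x))).

Definition cint f : R[i] :=
  (\int[mu]_x complex.Re (f x)) +i* (\int[mu]_x complex.Im (f x)).

Lemma complexReM (a b : R[i]) :
  complex.Re (a * b) = complex.Re a * complex.Re b - complex.Im a * complex.Im b.
Proof. by case: a; case: b. Qed.

Lemma complexImM (a b : R[i]) :
  complex.Im (a * b) = complex.Im a * complex.Re b + complex.Re a * complex.Im b.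
Proof. by case: a => a1 a2; case: b => b1 b2 /=; rewrite addrC. Qed.

Lemma cintegrableD f g : cintegrable f -> cintegrable g -> cintegrable (fun x => f x + g x).
Proof.
move=> [fr fi] [gr gi]; split.
- have := integrableD measurableT fr gr; congr (integrable _ _ _).
  by apply/funext => x /=; rewrite raddfD.
- have := integrableD measurableT fi gi; congr (integrable _ _ _).
  by apply/funext => x /=; rewrite raddfD.
Qed.

Lemma cintD f g : cintegrable f -> cintegrable g ->
  cint (fun x => f x + g x) = cint f + cint g.
Proof.
move=> [fr fi] [gr gi]; rewrite /cint; apply/eqP; rewrite eq_complex /=.
rewrite -!RintegralD//.
by apply/andP; split; apply/eqP; apply: eq_Rintegral => x _; rewrite raddfD.
Qed.

Lemma integrableZlR (k : R) (f : R -> R) : mu.-integrable setT (EFin \o f) ->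
  mu.-integrable setT (EFin \o (fun x => k * f x)).
Proof. by move=> /(integrableZl measurableT k). Qed.

Lemma cintegrableZ c f : cintegrable f -> cintegrable (fun x => c * f x).
Proof.
move=> [fr fi]; split.
- have := integrableB measurableT (integrableZlR (complex.Re c) fr) (integrableZlR (complex.Im c) fi).
  by congr (integrable _ _ _); apply/funext => x /=; rewrite complexReM.
- have := integrableD measurableT (integrableZlR (complex.Im c) fr) (integrableZlR (complex.Re c) fi).
  by congr (integrable _ _ _); apply/funext => x /=; rewrite complexImM.
Qed.

Lemma cintZ c f : cintegrable f -> cint (fun x => c * f x) = c * cint f.
Proof.
move=> [fr fi]; rewrite /cint; apply/eqP; rewrite eq_complex complexReM complexImM /=.
rewrite -!RintegralZl// -RintegralB// -?RintegralD//; try exact: integrableZlR.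
by apply/andP; split; apply/eqP; apply: eq_Rintegral => x _; rewrite ?complexReM ?complexImM.
Qed.

Lemma cint_conj f : cintegrable f -> cint (fun x => cj (f x)) = cj (cint f).
Proof.
move=> [fr fi]; rewrite /cint; apply/eqP; rewrite eq_complex /=; apply/andP; split; apply/eqP.
  by apply: eq_Rintegral => x _; case: (f x).
rewrite -[RHS]mulN1r -RintegralZl//.
by apply: eq_Rintegral => x _; case: (f x) => a b /=; rewrite mulN1r.
Qed.

Lemma cintegrable_conj f : cintegrable f -> cintegrable (fun x => cj (f x)).
Proof.
move=> [fr fi]; split.
  by move: fr; congr (integrable _ _ _); apply/funext => x /=; case: (f x).
have := integrableZlR (-1) fi; congr (integrable _ _ _).
by apply/funext => x /=; case: (f x) => a b /=; rewrite mulN1r.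
Qed.

Lemma integrable_cstR (r : R) : mu.-integrable setT (EFin \o (fun=> r)).
Proof.
by apply: finite_measure_integrable_cst.
Qed.

Lemma cintegrable_cst c : cintegrable (fun=> c).
Proof. by split; exact: integrable_cstR. Qed.

Lemma cint_cst c : cint (fun=> c) = c.
Proof.
rewrite /cint !Rintegral_cst//.
have mu1 : fine (mu [set: measurableTypeR R]) = 1 := congr1 fine (probability_setT mu).
by case: c => a b /=; rewrite mu1 !mulr1.
Qed.

Lemma cintegrable_sum (I : Type) (r : seq I) (f : I -> R -> R[i]) :
  (forall i, cintegrable (f i)) -> cintegrable (fun x => \sum_(i <- r) f i x).
Proof.
move=> fi; elim: r => [|i r IH].
  by rewrite (_ : (fun _ => _) = fun=> 0); [exact: cintegrable_cst|apply/funext => x; rewrite big_nil].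
rewrite (_ : (fun _ => _) = fun x => f i x + \sum_(j <- r) f j x).
  exact: cintegrableD.
by apply/funext => x; rewrite big_cons.
Qed.

Lemma cint_sum (I : Type) (r : seq I) (f : I -> R -> R[i]) :
  (forall i, cintegrable (f i)) ->
  cint (fun x => \sum_(i <- r) f i x) = \sum_(i <- r) cint (f i).
Proof.
move=> fi; elim: r => [|i r IH].
  by rewrite big_nil -[RHS]cint_cst; congr cint; apply/funext => x; rewrite big_nil.
rewrite big_cons -IH -cintD//; last exact: cintegrable_sum.
by congr cint; apply/funext => x; rewrite big_cons.
Qed.

(** In the order of [R[i]], nonnegative means real and nonnegative, so the imaginary part has
    integral zero. *)
Lemma cint_ge0 f : (forall x, 0 <= f x) -> 0 <= cint f.
Proof.
move=> f0; rewrite lecE /=; apply/andP; split.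
  rewrite (@eq_Rintegral _ _ _ _ _ (fun=> 0)) ?Rintegral_cst ?mul0r// => x _.
  by apply/eqP; have := f0 x; rewrite lecE /= eq_sym => /andP[].
by apply: Rintegral_ge0 => x _; have := f0 x; rewrite lecE => /andP[].
Qed.

Lemma bounded_integrable (f : R -> R) (M : R) : measurable_fun setT f ->
  (forall x, `|f x| <= M) -> mu.-integrable setT (EFin \o f).
Proof.
move=> mf fM; apply: (le_integrable measurableT _ _ (integrable_cstR M)).
  exact/measurable_EFinP.
move=> x _ /=; rewrite lee_fin; apply: le_trans (fM x) _.
exact: ler_norm.
Qed.

Definition resolvent w (x : R) : R[i] := (w - x%:C)^-1.

Lemma cauchy_transformE w : cauchy_transform mu w = cint (resolvent w).
Proof. by []. Qed.

Lemma subRI (w : R[i]) (x : R) :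
  w - x%:C = (complex.Re w - x) +i* complex.Im w.
Proof. by case: w => a b; apply/eqP; rewrite eq_complex /= subr0 !eqxx. Qed.

Lemma resolventE w x : resolvent w x =
  ((complex.Re w - x) / ((complex.Re w - x) ^+ 2 + complex.Im w ^+ 2)) +i*
  (- (complex.Im w / ((complex.Re w - x) ^+ 2 + complex.Im w ^+ 2))).
Proof. by rewrite /resolvent subRI. Qed.

Lemma subRI_neq0 w x : 0 < complex.Im w -> w - x%:C != 0.
Proof.
by move=> w0; rewrite subRI eq_complex /= negb_and (gt_eqF w0) orbT.
Qed.

Lemma resolvent_den_gt0 w x : 0 < complex.Im w ->
  0 < (complex.Re w - x) ^+ 2 + complex.Im w ^+ 2.
Proof. by move=> w0; rewrite ltr_wpDl ?sqr_ge0 ?exprn_gt0. Qed.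

Lemma resolvent_den_continuous w : 0 < complex.Im w ->
  continuous (fun x => ((complex.Re w - x) ^+ 2 + complex.Im w ^+ 2)^-1).
Proof.
move=> w0 x; apply: (@cvgV _ _ _ _ (fun x => (complex.Re w - x) ^+ 2 + complex.Im w ^+ 2)).
  by rewrite gt_eqF ?resolvent_den_gt0.
apply: cvgD; last exact: cvg_cst.
have cB : (fun x => complex.Re w - x) @ x --> complex.Re w - x.
  by apply: cvgB; [exact: cvg_cst|exact: cvg_id].
exact: (cvgM cB cB).
Qed.

Lemma Re_resolvent_le w x : 0 < complex.Im w ->
  `|complex.Re (resolvent w x)| <= (complex.Im w)^-1.
Proof.
move=> w0; have d0 := resolvent_den_gt0 x w0.
rewrite resolventE /= normrM normfV (gtr0_norm d0) ler_pdivrMr// ler_pdivlMl//.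
move: (complex.Re w - x) (complex.Im w) w0 => u v v0; rewrite -(real_normK (num_real u)).
have := sqr_ge0 (`|u| - v); have := normr_ge0 u; nra.
Qed.

Lemma Im_resolvent_le w x : 0 < complex.Im w ->
  `|complex.Im (resolvent w x)| <= (complex.Im w)^-1.
Proof.
move=> w0; have d0 := resolvent_den_gt0 x w0.
rewrite resolventE /= normrN normrM normfV (gtr0_norm d0) (gtr0_norm w0) ler_pdivrMr//.
by rewrite ler_pdivlMl// -expr2 lerDr sqr_ge0.
Qed.

Lemma measurable_Re_resolvent w : 0 < complex.Im w ->
  measurable_fun setT (fun x => complex.Re (resolvent w x)).
Proof.
move=> /resolvent_den_continuous cd; apply: continuous_measurable_fun => x.
rewrite (_ : (fun x => _) = fun x => (complex.Re w - x) *
    ((complex.Re w - x) ^+ 2 + complex.Im w ^+ 2)^-1).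
  by apply: cvgM; [apply: cvgB; [exact: cvg_cst|exact: cvg_id]|exact: cd].
by apply/funext => y; rewrite resolventE.
Qed.

Lemma measurable_Im_resolvent w : 0 < complex.Im w ->
  measurable_fun setT (fun x => complex.Im (resolvent w x)).
Proof.
move=> /resolvent_den_continuous cd; apply: continuous_measurable_fun => x.
rewrite (_ : (fun x => _) = fun x => - (complex.Im w *
    ((complex.Re w - x) ^+ 2 + complex.Im w ^+ 2)^-1)).
  by apply: cvgN; apply: cvgM; [exact: cvg_cst|exact: cd].
by apply/funext => y; rewrite resolventE.
Qed.

Lemma cintegrable_resolvent w : 0 < complex.Im w -> cintegrable (resolvent w).
Proof.
move=> w0; split.
  apply: bounded_integrable (measurable_Re_resolvent w0) _ => x.
  exact: Re_resolvent_le.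
apply: bounded_integrable (measurable_Im_resolvent w0) _ => x.
exact: Im_resolvent_le.
Qed.

Lemma sub_conj_neq0 w w' : 0 < complex.Im w -> 0 < complex.Im w' -> w - cj w' != 0.
Proof.
case: w => a b; case: w' => c d /= b0 d0; rewrite eq_complex /= negb_and opprK.
by rewrite (gt_eqF (addr_gt0 b0 d0)) orbT.
Qed.

(** The resolvent identity: it makes the integral of a product of two resolvents a difference of
    Cauchy transforms. *)
Lemma resolvent_mul_conj w w' x : 0 < complex.Im w -> 0 < complex.Im w' ->
  resolvent w x * cj (resolvent w' x) =
  (w - cj w')^-1 * (cj (resolvent w' x) - resolvent w x).
Proof.
move=> w0 w'0; rewrite /resolvent. rewrite cjV.
have wx := subRI_neq0 x w0; have w'x := subRI_neq0 x w'0.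
have -> : cj (w' - x%:C) = cj w' - x%:C by rewrite cjB conjc_real.
have w'x' : cj w' - x%:C != 0 by rewrite -(conjc_real x) -cjB conjc_eq0.
have ww' := sub_conj_neq0 w0 w'0.
by field; rewrite ww' w'x' wx.
Qed.

(** With $g_i=F_ih_i-1$ and $\int h_i\,d\mu=1/F_i$, the resolvent identity evaluates $\int
    g_i\overline{g_j}\,d\mu$: the product term gives the difference quotient, the two mixed terms
    give $-1$ each, and the constant gives $1$. *)
Lemma pick_kernel_ge0 n (w c : 'I_n -> R[i]) :
  (forall i, 0 < complex.Im (w i)) -> (forall i, reciprocal_cauchy mu (w i) != 0) ->
  0 <= \sum_i \sum_j c i * cj (c j) *
    ((reciprocal_cauchy mu (w i) - (cj (reciprocal_cauchy mu (w j)))) / (w i - cj (w j)) - 1).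
Proof.
move=> w0 F0.
pose F i := reciprocal_cauchy mu (w i); pose h i := resolvent (w i).
have hi i : cintegrable (h i) by exact: cintegrable_resolvent.
have G i : cint (h i) = (F i)^-1 by rewrite -cauchy_transformE invrK.
have hh i j : cintegrable (fun x => h i x * cj (h j x)) /\
    cint (fun x => h i x * cj (h j x)) = (w i - cj (w j))^-1 * (cj (F j)^-1 - (F i)^-1).
  have -> : (fun x => h i x * cj (h j x)) =
      fun x => (w i - cj (w j))^-1 * (cj (h j x) + -1 * h i x).
    by apply/funext => x; rewrite resolvent_mul_conj// mulN1r.
  have hj : cintegrable (fun x => cj (h j x) + -1 * h i x).
    by apply: cintegrableD; [exact: cintegrable_conj|exact: cintegrableZ].
  split; first exact: cintegrableZ.
  rewrite cintZ// cintD ?cint_conj ?cintZ ?G ?mulN1r//; [exact: cintegrable_conj|exact: cintegrableZ].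
pose g i x := F i * h i x - 1.
have gE i j x : g i x * cj (g j x) = F i * cj (F j) * (h i x * cj (h j x)) +
    (- F i * h i x + (- cj (F j) * cj (h j x) + 1)).
  by rewrite /g cjB cjM conjc1; ring.
have gg i j : cintegrable (fun x => g i x * cj (g j x)) /\
    cint (fun x => g i x * cj (g j x)) = (F i - cj (F j)) / (w i - cj (w j)) - 1.
  have [hh1 hh2] := hh i j.
  have i1 := cintegrableZ (F i * cj (F j)) hh1.
  have i2 := cintegrableZ (- F i) (hi i).
  have i3 := cintegrableZ (- cj (F j)) (cintegrable_conj (hi j)).
  have i4 := cintegrableD i3 (cintegrable_cst 1).
  have i5 := cintegrableD i2 i4.
  rewrite (funext (gE i j)); split; first exact: cintegrableD.
  rewrite cintD// cintD// cintD//; last exact: cintegrable_cst.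
  rewrite cint_cst cintZ// cintZ// cintZ//; last exact: cintegrable_conj.
  rewrite hh2 cint_conj// !G cjV.
  have Fi0 : F i != 0 := F0 i; have Fj0 : cj (F j) != 0 by rewrite conjc_eq0; exact: F0.
  have := sub_conj_neq0 (w0 i) (w0 j) => wij.
  by field; rewrite wij Fi0 Fj0.
have -> : \sum_i \sum_j c i * cj (c j) *
    ((reciprocal_cauchy mu (w i) - (cj (reciprocal_cauchy mu (w j)))) / (w i - cj (w j)) - 1) =
    cint (fun x => \sum_i \sum_j c i * cj (c j) * (g i x * cj (g j x))).
  rewrite cint_sum => [|i]; last first.
    by apply: cintegrable_sum => j; apply: cintegrableZ; have [] := gg i j.
  apply: eq_bigr => i _; rewrite cint_sum => [|j]; last first.
    by apply: cintegrableZ; have [] := gg i j.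
  by apply: eq_bigr => j _; have [gg1 gg2] := gg i j; rewrite cintZ// gg2.
apply: cint_ge0 => x.
have -> : \sum_i \sum_j c i * cj (c j) * (g i x * cj (g j x)) =
    (\sum_i c i * g i x) * cj (\sum_i c i * g i x).
  rewrite rmorph_sum /= big_distrl /=; apply: eq_bigr => i _.
  rewrite big_distrr /=; apply: eq_bigr => j _.
  by rewrite cjM; ring.
exact: mulcJ_ge0.
Qed.

End complex_integral.


(** * Moments of the beta law and their recursion *)

Section beta_moment_recursion.
Context {R : realType}.
Local Notation leb := (@lebesgue_measure R).

Lemma integral_null_compl (mu : probability (measurableTypeR R) R)
    (D : set (measurableTypeR R)) (f : R -> \bar R) :
  measurable D -> mu (~` D) = 0%E -> measurable_fun setT f ->
  (\int[mu]_x f x = \int[mu]_(x in D) f x)%E.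
Proof.
move=> mD D0 mf; rewrite [RHS]integral_mkcond; apply: ae_eq_integral => //.
  by apply/(measurable_restrict _ mD) => //; rewrite setTI; exact: measurable_funTS.
exists (~` D); split => //; first exact: measurableC.
move=> x /= h xD; apply: h => _; rewrite patchE.
by case: ifPn => //; rewrite notin_setE.
Qed.

Variables (p q : R) (p0 : 0 < p) (q0 : 0 < q).
Let nu : probability (measurableTypeR R) R := beta_distribution p0 q0.
Let I01 : set (measurableTypeR R) := `]0%R, 1%R[%classic.

Let mI01 : measurable I01. Proof. exact: measurable_itv. Qed.

Lemma beta_distribution_supp : beta_distribution p0 q0 (~` `]0%R, 1%R[%classic) = 0%E.
Proof.
rewrite /beta_distribution /beta_law; apply: integral0_eq => x /= x01.
rewrite /beta_density; case: ifP => // h; exfalso; exact: x01.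
Qed.

Lemma beta_distribution_dominates : nu `<< leb.
Proof.
apply/null_content_dominatesP => A mA A0.
rewrite /nu /= /beta_distribution /beta_law.
apply: (@null_set_integral _ _ _ leb) => //.
by apply/measurable_funTS/measurableT_comp => //; exact: measurable_beta_density.
Qed.

(** [beta_density] is almost everywhere the Radon-Nikodym derivative of [nu], since the two have the
    same integral over every measurable set. *)
Lemma integral_beta_distribution (f : R -> \bar R) U : measurable (U : set (measurableTypeR R)) ->
  nu.-integrable U f ->
  (\int[nu]_(x in U) f x = \int[leb]_(x in U) (f x * (beta_density p q x)%:E))%E.
Proof.
move=> mU fi.
have md : measurable_fun setT (fun x => (beta_density p q x)%:E).
  by apply: measurableT_comp => //; exact: measurable_beta_density.
have dom := beta_distribution_dominates.
rewrite -(Radon_Nikodym_change_of_variables dom)//=.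
apply: ae_eq_integral => //.
- apply: emeasurable_funM => //; first exact: (measurable_int nu).
  apply: (measurable_int leb).
  apply: (integrableS _ _ (@subsetT _ _)) => //=.
  by apply: Radon_Nikodym_integrable; exact: dom.
- apply: emeasurable_funM => //=; first exact: (measurable_int nu).
  exact: measurable_funTS.
- apply: ae_eqe_mul2l => /=.
  rewrite Radon_NikodymE//=; case: cid => /= h [h1 h2 h3].
  apply: integral_ae_eq => //=.
  + exact: integrableS h2.
  + exact: measurable_funTS.
  + by move=> E E01 mE; rewrite -h3.
Qed.

(** Multiplication by $x^n$ shifts the first parameter of the kernel by $n$. The shift is valid on
    $(0,1)$, to which the integral is first reduced; there $x^n\le1$ also gives integrability. *)
Lemma beta_moment n : moment nu n = euler_beta (p + n%:R) q / euler_beta p q.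
Proof.
have pn0 : 0 < p + n%:R by rewrite ltr_wpDr.
have mX : measurable_fun (setT : set (measurableTypeR R)) (fun x : R => (x ^+ n)%:E).
  by apply: measurableT_comp => //; exact: exprn_measurable.
rewrite /moment /Rintegral (integral_null_compl mI01 _ mX)//; last exact: beta_distribution_supp.
rewrite integral_beta_distribution//; last first.
  apply: (le_integrable mI01 _ _ (finite_measure_integrable_cst nu 1 _)) => //.
    exact: measurable_funTS.
  move=> x; rewrite /I01/= in_itv/= => /andP[x0 x1].
  by rewrite lee_fin normr1 normrX ger0_norm ?exprn_ile1// ltW.
have -> : (\int[leb]_(x in I01) ((x ^+ n)%:E * (beta_density p q x)%:E) =
    \int[leb]_(x in I01) ((euler_beta p q)^-1%:E * (beta_kernel (p + n%:R) q x)%:E))%E.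
  apply: eq_integral => x; rewrite inE /I01/= in_itv/= => x01.
  rewrite -!EFinM /beta_density x01; congr EFin.
  have -> : beta_kernel (p + n%:R) q x = x ^+ n * beta_kernel p q x.
    elim: {pn0 mX} n => [|n IH]; first by rewrite addr0 expr0 mul1r.
    by rewrite -natr1 addrA beta_kernelSl// IH exprS mulrA.
  by rewrite mulrA mulrC.
rewrite ge0_integralZl_EFin//=; last 3 first.
- by move=> x _; rewrite lee_fin beta_kernel_ge0.
- apply: measurable_funTS; apply: measurableT_comp => //.
  exact: measurable_beta_kernel.
- by rewrite invr_ge0 ltW ?euler_beta_gt0.
by rewrite EFin_euler_beta//= mulrC.
Qed.

Lemma beta_momentS n :
  moment nu n.+1 = (p + n%:R) / (p + q + n%:R) * moment nu n.
Proof.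
have pn0 : 0 < p + n%:R by rewrite ltr_wpDr.
rewrite !beta_moment -natr1 addrA euler_betaSl// mulrA; congr (_ / _ * _ / _).
by rewrite addrAC.
Qed.

Lemma beta_moment0 : moment nu 0 = 1.
Proof. by rewrite beta_moment addr0 divff// gt_eqF ?euler_beta_gt0. Qed.

End beta_moment_recursion.

(** * The Hankel determinant *)

Section determinant.
Context {R : realType}.
Implicit Types (s u d x : R) (m kappa : nat -> R).

Lemma det3_sum (F : nat -> R) : \det (\matrix_(i < 3, j < 3) F (i + j + 2)%N) =
  F 2%N * F 4%N * F 6%N + 2 * F 3%N * F 4%N * F 5%N - F 4%N ^+ 3
  - F 2%N * F 5%N ^+ 2 - F 3%N ^+ 2 * F 6%N.
Proof.
rewrite (expand_det_row _ ord0) !big_ord_recl big_ord0 /cofactor.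
rewrite !(expand_det_row _ ord0) !big_ord_recl !big_ord0 /cofactor !det_mx11 !mxE /=.
rewrite !/bump /=.
rewrite /= !addn0 !add0n /=. 
ring.
Qed.

(** Here $x=p/s$ is the mean. The reflection $x\mapsto1-x$ changes the sign of odd cumulants and
    fixes even ones of order at least two; hence the factor $d=1-2x$ in $\kappa_3,\kappa_5$, while
    all else is a function of $s$ and $u=x(1-x)$. *)
Lemma beta_free_cumulants m kappa x s : 0 < s -> moment_cumulant m kappa ->
  m 0%N = 1 -> (forall n, m n.+1 = (x * s + n%:R) / (s + n%:R) * m n) ->
  let u := x * (1 - x) in let d := 1 - 2 * x in
  [/\ kappa 2%N = u / (s + 1),
      kappa 3%N = d * (2 * u / ((s + 1) * (s + 2))),
      kappa 4%N = u * (6 * (s + 1) + u * (s ^+ 2 - 25 * s - 30))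
                  / ((s + 1) ^+ 2 * (s + 2) * (s + 3)),
      kappa 5%N = d * (u * (24 * (s + 1) + u * (10 * s ^+ 2 - 98 * s - 168))
                  / ((s + 1) ^+ 2 * (s + 2) * (s + 3) * (s + 4))) &
      kappa 6%N = u * (120 * (s + 1) ^+ 2 * (s + 2)
        + u * (82 * s ^+ 4 - 668 * s ^+ 3 - 4222 * s ^+ 2 - (6 * 1000 + 832) * s - 3360)
        + u ^+ 2 * (4 * s ^+ 5 - 318 * s ^+ 4 + 686 * s ^+ 3 + (9 * 1000 + 72) * s ^+ 2
                    + (17 * 1000 + 976) * s + (10 * 1000 + 80)))
        / ((s + 1) ^+ 3 * (s + 2) ^+ 2 * (s + 3) * (s + 4) * (s + 5))].
Proof.
move=> s0 mk m0 mS u d.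
have [+ + + + []] := moment_cumulant6 mk.
have s1 : s + 1 != 0 by rewrite gt_eqF//; lra.
have s2 : s + 2 != 0 by rewrite gt_eqF//; lra.
have s3 : s + 3 != 0 by rewrite gt_eqF//; lra.
have s4 : s + 4 != 0 by rewrite gt_eqF//; lra.
have s5 : s + 5 != 0 by rewrite gt_eqF//; lra.
have s00 : s != 0 by rewrite gt_eqF.
have m1 : m 1%N = x by rewrite mS m0 !addr0 mulr1 mulfK.
have m2 : m 2%N = (x * s + 1) / (s + 1) * x by rewrite mS m1.
have m3 := mS 2%N; have m4 := mS 3%N; have m5 := mS 4%N; have m6 := mS 5%N.
rewrite m6 m5 m4 m3 m2 m1; clear m1 m2 m3 m4 m5 m6 mS m0 mk.
move: (kappa 1%N) (kappa 2%N) (kappa 3%N) (kappa 4%N) (kappa 5%N) (kappa 6%N).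
move=> k1 k2 k3 k4 k5 k6 <- h2 h3 h4 h5 h6.
have e2 : k2 = u / (s + 1).
  by rewrite -[LHS](addrK (x ^+ 2)) -h2 /u; field.
have e3 : k3 = d * (2 * u / ((s + 1) * (s + 2))).
  (* Each cumulant is written as its moment formula minus the lower terms, so that the known moment
     and the cumulants already computed can be substituted. *)
  rewrite (_ : k3 = (k3 + 3 * k2 * x + x ^+ 3) - 3 * k2 * x - x ^+ 3); last by ring.
  by rewrite -h3 e2 /u /d; field; rewrite s1 s2.
have e4 : k4 = u * (6 * (s + 1) + u * (s ^+ 2 - 25 * s - 30))
                  / ((s + 1) ^+ 2 * (s + 2) * (s + 3)).
  rewrite (_ : k4 = (k4 + 4 * k3 * x + 2 * k2 ^+ 2 + 6 * k2 * x ^+ 2 + x ^+ 4)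
    - 4 * k3 * x - 2 * k2 ^+ 2 - 6 * k2 * x ^+ 2 - x ^+ 4); last by ring.
  by rewrite -h4 e3 e2 /u /d; field; rewrite s1 s2 s3.
have e5 : k5 = d * (u * (24 * (s + 1) + u * (10 * s ^+ 2 - 98 * s - 168))
                  / ((s + 1) ^+ 2 * (s + 2) * (s + 3) * (s + 4))).
  rewrite (_ : k5 = (k5 + 5 * k4 * x + 5 * k3 * k2 + 10 * k3 * x ^+ 2 + 10 * k2 ^+ 2 * x
              + 10 * k2 * x ^+ 3 + x ^+ 5) - (5 * k4 * x + 5 * k3 * k2 + 10 * k3 * x ^+ 2
              + 10 * k2 ^+ 2 * x + 10 * k2 * x ^+ 3 + x ^+ 5)); last by ring.
  by rewrite -h5 e4 e3 e2 /u /d; field; rewrite s1 s2 s3 s4.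
split => //.
rewrite (_ : k6 = (k6 + 6 * k5 * x + 6 * k4 * k2 + 3 * k3 ^+ 2 + 15 * k4 * x ^+ 2
              + 30 * k3 * k2 * x + 5 * k2 ^+ 3 + 20 * k3 * x ^+ 3
              + 30 * k2 ^+ 2 * x ^+ 2 + 15 * k2 * x ^+ 4 + x ^+ 6)
            - (6 * k5 * x + 6 * k4 * k2 + 3 * k3 ^+ 2 + 15 * k4 * x ^+ 2
              + 30 * k3 * k2 * x + 5 * k2 ^+ 3 + 20 * k3 * x ^+ 3
              + 30 * k2 ^+ 2 * x ^+ 2 + 15 * k2 * x ^+ 4 + x ^+ 6)); last by ring.
by rewrite -h6 e5 e4 e3 e2 /u /d; field; rewrite s1 s2 s3 s4 s5.
Qed.

(** Every term of the determinant has even degree in $(\kappa_3,\kappa_5)$, so $d$ enters only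
    through $d^2=1-4u$ and the result depends on $s$ and $u$ alone. *)
Lemma D2_identity s u d (k2 k3 k4 k5 k6 : R) : 0 < s -> d ^+ 2 = 1 - 4 * u ->
  k2 = u / (s + 1) ->
  k3 = d * (2 * u / ((s + 1) * (s + 2))) ->
  k4 = u * (6 * (s + 1) + u * (s ^+ 2 - 25 * s - 30))
                  / ((s + 1) ^+ 2 * (s + 2) * (s + 3)) ->
  k5 = d * (u * (24 * (s + 1) + u * (10 * s ^+ 2 - 98 * s - 168))
                  / ((s + 1) ^+ 2 * (s + 2) * (s + 3) * (s + 4))) ->
  k6 = u * (120 * (s + 1) ^+ 2 * (s + 2)
        + u * (82 * s ^+ 4 - 668 * s ^+ 3 - 4222 * s ^+ 2 - (6 * 1000 + 832) * s - 3360)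
        + u ^+ 2 * (4 * s ^+ 5 - 318 * s ^+ 4 + 686 * s ^+ 3 + (9 * 1000 + 72) * s ^+ 2
                    + (17 * 1000 + 976) * s + (10 * 1000 + 80)))
        / ((s + 1) ^+ 3 * (s + 2) ^+ 2 * (s + 3) * (s + 4) * (s + 5)) ->
  k2 * k4 * k6 + 2 * k3 * k4 * k5 - k4 ^+ 3 - k2 * k5 ^+ 2 - k3 ^+ 2 * k6 =
  u ^+ 3 * P2 s u /
    ((s + 1) ^+ 6 * (s + 2) ^+ 4 * (s + 3) ^+ 3 * (s + 4) ^+ 2 * (s + 5)).
Proof.
move=> s0 d2 -> -> -> -> ->.
have s1 : s + 1 != 0 by rewrite gt_eqF//; lra.
have s2 : s + 2 != 0 by rewrite gt_eqF//; lra.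
have s3 : s + 3 != 0 by rewrite gt_eqF//; lra.
have s4 : s + 4 != 0 by rewrite gt_eqF//; lra.
have s5 : s + 5 != 0 by rewrite gt_eqF//; lra.
rewrite /P2 /A0 /A1 /A2 /A3.
set K3 := 2 * u / _; set K5 := u * _ / ((s + 1) ^+ 2 * (s + 2) * (s + 3) * (s + 4)).
set K4 := u * _ / _; set K6 := u * _ / _.
transitivity (u / (s + 1) * K4 * K6 - K4 ^+ 3
  + d ^+ 2 * (2 * K3 * K4 * K5 - u / (s + 1) * K5 ^+ 2 - K3 ^+ 2 * K6)); first by ring.
rewrite d2 /K3 /K4 /K5 /K6.
by field; rewrite s1 s2 s3 s4 s5.
Qed.

Lemma psd2_disc (a b c : R) :
  (forall x y, 0 <= a * x ^+ 2 + 2 * b * x * y + c * y ^+ 2) -> b ^+ 2 <= a * c.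
Proof.
move=> psd; have a0 : 0 <= a by have := psd 1 0; lra.
have [a_gt0|] := ltP 0 a.
  (* The form at $(-b,a)$ equals $a(ac-b^2)$. *)
  have : 0 <= a * (a * c - b ^+ 2) by have := psd (- b) a; nra.
  by rewrite pmulr_rge0// subr_ge0.
move=> a_le0; have -> : a = 0 by lra.
have [->|b0] := eqVneq b 0; first by rewrite expr0n mul0r.
(* With $a=0$ and $b\ne0$ the form is affine in $x$ on the line $y=1$; this point gives it the value
   $-1$. *)
have := psd (- (c + 1) / (2 * b)) 1.
have -> : a * (- (c + 1) / (2 * b)) ^+ 2 + 2 * b * (- (c + 1) / (2 * b)) * 1 + c * 1 ^+ 2 =
    a * (- (c + 1) / (2 * b)) ^+ 2 - 1 by field.
have -> : a = 0 by lra.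
lra.
Qed.

(** For $a>0$ the Schur complement, scaled by $a$ to avoid division, is a semidefinite binary form
    whose discriminant inequality reads $a\det\ge0$. For $a=0$ the first row vanishes and the
    determinant is zero. *)
Lemma psd3_det_ge0 (a b c d e f : R) :
  (forall x y z, 0 <= a * x ^+ 2 + d * y ^+ 2 + f * z ^+ 2
     + 2 * b * x * y + 2 * c * x * z + 2 * e * y * z) ->
  0 <= a * d * f + 2 * b * c * e - a * e ^+ 2 - d * c ^+ 2 - f * b ^+ 2.
Proof.
move=> psd; have a0 : 0 <= a by have := psd 1 0 0; lra.
have [a_gt0|a_le0] := ltP 0 a; last first.
  have a00 : a = 0 by lra.
  have : b ^+ 2 <= a * d by apply: psd2_disc => x y; have := psd x y 0; lra.
  have : c ^+ 2 <= a * f by apply: psd2_disc => x y; have := psd x 0 y; lra.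
  rewrite a00 !mul0r => c2 b2.
  have /eqP : c ^+ 2 = 0 by apply/eqP; rewrite eq_le c2 sqr_ge0.
  have /eqP : b ^+ 2 = 0 by apply/eqP; rewrite eq_le b2 sqr_ge0.
  by rewrite !sqrf_eq0 => /eqP -> /eqP ->; lra.
have : (a * e - b * c) ^+ 2 <= (a * d - b ^+ 2) * (a * f - c ^+ 2).
  apply: psd2_disc => y z; have := psd (- (b * y + c * z)) (a * y) (a * z).
  rewrite (_ : a * _ + _ + _ + _ + _ + _ = a * ((a * d - b ^+ 2) * y ^+ 2
     + 2 * (a * e - b * c) * y * z + (a * f - c ^+ 2) * z ^+ 2)); last by ring.
  by rewrite pmulr_rge0.
rewrite -subr_ge0 (_ : _ - _ = a * (a * d * f + 2 * b * c * e - a * e ^+ 2 -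
  d * c ^+ 2 - f * b ^+ 2)); last by ring.
by rewrite pmulr_rge0.
Qed.

End determinant.

(** * Voiculescu transforms of free powers *)

Section voiculescu.
Context {R : realType}.
Local Open Scope complex_scope.
Implicit Types (mu nu rho : probability (measurableTypeR R) R).

Lemma Rintegral_gt0 mu (k : R -> R) :
  mu.-integrable setT (EFin \o k) -> (forall x, 0 < k x) -> 0 < \int[mu]_x k x.
Proof.
move=> ki k0; rewrite lt_neqAle eq_sym Rintegral_ge0 ?andbT => [|x _]; last exact: ltW.
apply/eqP => I0.
have I0E : (\int[mu]_x `|(k x)%:E| = 0)%E.
  rewrite -[RHS](congr1 EFin I0) /Rintegral fineK; last exact: integrable_fin_num.
  by apply: eq_integral => x _; rewrite gee0_abs// lee_fin ltW.
have mk := measurable_int _ ki.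
have /(ae_eq_integral_abs _ measurableT mk) := I0E.
move=> [N [mN N0 sub]].
have : (mu setT <= mu N)%E.
  apply: le_measure; rewrite ?inE//.
  by move=> x _; apply: sub => /= /(_ I) [] h; have := k0 x; rewrite h ltxx.
rewrite probability_setT.
have -> : mu N = 0%E by exact: N0.
by rewrite lee_fin ler10.
Qed.

(** On the part of the cone below height $N$, $-\mathrm{Im}\,G_\mu$ has a positive lower bound $J$,
    and $\mathrm{Im}(1/G)=-\mathrm{Im}\,G/|G|^2\le1/J$. Hence a large imaginary part of $F_\mu(w)$
    forces one of $w$. *)
Lemma Im_reciprocal_cauchy_bound mu (l M N : R) : 0 < l -> 0 < M ->
  exists C : R, forall w, truncated_cone l M w -> complex.Im w <= N ->
    complex.Im (reciprocal_cauchy mu w) <= C.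
Proof.
move=> l0 M0.
(* A lower bound, uniform in w, of the integrand of - Im G(w). *)
pose k x : R := M * (2 * x ^+ 2 + (2 * l ^+ 2 + 1) * N ^+ 2 + 1)^-1.
have d0 x : 0 < 2 * x ^+ 2 + (2 * l ^+ 2 + 1) * N ^+ 2 + 1.
  have := sqr_ge0 x; have := sqr_ge0 l; have := sqr_ge0 N; nra.
have k0 x : 0 < k x by rewrite mulr_gt0 ?invr_gt0.
have kM x : `|k x| <= M.
  rewrite gtr0_norm// ler_piMr ?(ltW M0)// invf_le1 ?d0//.
  have := sqr_ge0 x; have := sqr_ge0 l; have := sqr_ge0 N; nra.
have ki : mu.-integrable setT (EFin \o k).
  apply: (@bounded_integrable _ mu k M _ kM); apply: continuous_measurable_fun => x.
  apply: cvgM; first exact: cvg_cst.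
  apply: (@cvgV _ _ _ _ (fun x => 2 * x ^+ 2 + (2 * l ^+ 2 + 1) * N ^+ 2 + 1)).
    by rewrite gt_eqF ?d0.
  apply: cvgD; last exact: cvg_cst.
  apply: cvgD; last exact: cvg_cst.
  by apply: cvgM; [exact: cvg_cst|exact: (cvgM cvg_id cvg_id)].
have I0 := Rintegral_gt0 ki k0; set J := \int[mu]_x k x in I0.
exists J^-1 => w [wM wl] wN.
have w0 : 0 < complex.Im w by exact: lt_trans wM.
have GJ : complex.Im (cauchy_transform mu w) <= - J.
  have [_ hi] := cintegrable_resolvent mu w0.
  rewrite -subr_le0 opprK -[X in X <= 0]opprK oppr_le0 opprD.
  have := RintegralB measurableT (integrableZlR (-1) hi) ki.
  rewrite RintegralZl// mulN1r => <-; apply: Rintegral_ge0 => x _.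
  rewrite resolventE /= mulN1r opprK subr_ge0 /k.
  have := resolvent_den_gt0 x w0; set u := complex.Re w in wl *; set v := complex.Im w in wM wl wN w0 *.
  move=> D0; apply: ler_pM; rewrite ?invr_ge0 ?(ltW M0) ?(ltW wM) ?(ltW (d0 _))//.
  rewrite lef_pV2 ?posrE ?d0//.
  have u2 : u ^+ 2 <= l ^+ 2 * N ^+ 2.
    rewrite -exprMn -(real_normK (num_real u)) lerXn2r ?nnegrE ?normr_ge0//.
      by rewrite mulr_ge0 ?(ltW l0)// (le_trans _ wN)// ltW.
    by apply: le_trans (ltW wl) _; rewrite ler_wpM2l// ltW.
  have v2 : v ^+ 2 <= N ^+ 2 by rewrite lerXn2r ?nnegrE ?(ltW w0)// (le_trans _ wN)// ltW.
  (* $(u+x)^2\ge0$ gives $(u-x)^2\le2u^2+2x^2$, the source of the constants in [k]. *)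
  have := sqr_ge0 (u + x); nra.
rewrite /reciprocal_cauchy; move: GJ.
case: (cauchy_transform mu w) => a b /= bJ.
have b0 : 0 < - b by lra.
have ab0 : 0 < a ^+ 2 + b ^+ 2 by rewrite ltr_wpDl ?sqr_ge0// -sqrrN exprn_gt0.
rewrite -mulNr ler_pdivrMr// -(ler_pM2l I0) mulrA mulfV ?gt_eqF// mul1r.
have := sqr_ge0 a; nra.
Qed.

Lemma truncated_coneS (a a' b b' : R) z : 0 < b -> a <= a' -> b <= b' ->
  truncated_cone a b' z -> truncated_cone a' b z.
Proof.
move=> b0 aa bb [h1 h2]; split; first exact: le_lt_trans h1.
apply: lt_le_trans h2 _; rewrite ler_wpM2r// ltW//.
by apply: lt_trans b0 _; apply: le_lt_trans h1.
Qed.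

Lemma voiculescu_transformS mu (a a' b b' : R) phi : 0 < b -> a' <= a -> b <= b' ->
  voiculescu_transform mu a b phi -> voiculescu_transform mu a' b' phi.
Proof.
move=> b0 aa bb [l [M [l0 M0 inj h]]]; exists l, M; split => // z zc.
by apply: h; exact: truncated_coneS zc.
Qed.

Lemma eq_voiculescu_transform mu (a b : R) phi phi' :
  (forall z, truncated_cone a b z -> phi z = phi' z) ->
  voiculescu_transform mu a b phi -> voiculescu_transform mu a b phi'.
Proof.
move=> e [l [M [l0 M0 inj h]]]; exists l, M; split => // z zc.
by rewrite -e//; exact: h.
Qed.

Lemma voiculescu_transform_Im mu (a b : R) phi (N : R) :
  voiculescu_transform mu a b phi ->
  exists C : R, forall z, truncated_cone a b z -> C < complex.Im z ->
    N < complex.Im (z + phi z).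
Proof.
move=> [l [M [l0 M0 _ h]]].
have [C hC] := @Im_reciprocal_cauchy_bound mu l M N l0 M0.
exists C => z zc zC; rewrite ltNge; apply/negP => wN.
have [wc Fw] := h z zc.
by have := hC _ wc wN; rewrite Fw; lra.
Qed.

(** The two right inverses may take values in different cones. The one with the narrower cone has,
    at high points, values above any level, hence inside the wider cone, where $F_\mu$ is
    injective. *)
Lemma voiculescu_transform_uniq mu (a b : R) phi phi' : 0 < b ->
  voiculescu_transform mu a b phi -> voiculescu_transform mu a b phi' ->
  exists b', b <= b' /\ forall z, truncated_cone a b' z -> phi z = phi' z.
Proof.
move=> b0.
(* By symmetry the first cone may be taken to have the smaller aperture. *)
suff main phi1 phi2 l1 M1 l2 M2 : l1 <= l2 -> 0 < l1 -> 0 < M1 -> 0 < M2 ->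
    set_inj (truncated_cone l2 M2) (reciprocal_cauchy mu) ->
    (forall z, truncated_cone a b z -> truncated_cone l1 M1 (z + phi1 z) /\
       reciprocal_cauchy mu (z + phi1 z) = z) ->
    (forall z, truncated_cone a b z -> truncated_cone l2 M2 (z + phi2 z) /\
       reciprocal_cauchy mu (z + phi2 z) = z) ->
    exists b', b <= b' /\ forall z, truncated_cone a b' z -> phi1 z = phi2 z.
  move=> [l1 [M1 [l10 M10 inj1 h1]]] [l2 [M2 [l20 M20 inj2 h2]]].
  have [l12|/ltW l21] := leP l1 l2; first exact: (main _ _ l1 M1 l2 M2).
  have [b' [bb' e]] := main phi' phi l2 M2 l1 M1 l21 l20 M20 M10 inj1 h2 h1.
  by exists b'; split => // z /e.
move=> l12 l10 M10 M20 inj h1 h2.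
have [C hC] := @Im_reciprocal_cauchy_bound mu l1 M1 M2 l10 M10.
exists (Num.max b C); split; first by rewrite le_max lexx.
move=> z zc.
have zab : truncated_cone a b z by apply: truncated_coneS zc; rewrite // le_max lexx.
have [w1c F1] := h1 z zab; have [w2c F2] := h2 z zab.
have M2w : M2 < complex.Im (z + phi1 z).
  rewrite ltNge; apply/negP => wN.
  have := hC _ w1c wN; rewrite F1; have [+ _] := zc; rewrite gt_max => /andP[_].
  lra.
have w1c' : truncated_cone l2 M2 (z + phi1 z).
  split=> //; have [_ h] := w1c; apply: lt_le_trans h _.
  by rewrite ler_wpM2r// ltW// (lt_trans M20).
have : z + phi1 z = z + phi2 z by apply: inj; rewrite ?inE// F1 F2.
exact: addrI.
Qed.

(** The power $n=1$ stays apart because [free_power1] provides no Voiculescu transform. Each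
    convolution step brings its own transforms of the factors, which uniqueness identifies with the
    previous ones on a higher cone. *)
Lemma free_power_voiculescu mu n rho : free_power mu n rho ->
  (n = 1%N /\ rho = mu) \/ exists (a b : R) psi, [/\ 0 < a, 0 < b,
    voiculescu_transform mu a b psi &
    voiculescu_transform rho a b (fun z => n%:R * psi z)].
Proof.
elim=> [|{}n nu {}rho _ IH [a [b [phi [psi [a0 b0 Vnu Vmu Vrho]]]]]]; first by left.
right; case: IH => [[n1 numu]|[a1 [b1 [psi1 [a10 b10 Vmu1 Vnu1]]]]].
  rewrite numu in Vnu; have [b' [bb' e]] := voiculescu_transform_uniq b0 Vnu Vmu.
  exists a, b', psi; split => //; first exact: lt_le_trans bb'.
    exact: voiculescu_transformS Vmu.
  apply: (@eq_voiculescu_transform _ _ _ (phi \+ psi)); last exact: voiculescu_transformS Vrho.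
  by move=> z zc; rewrite n1 /= e// mulr_natl mulr2n.
pose a' := Num.min a a1; pose b' := Num.max b b1.
have a'0 : 0 < a' by rewrite lt_min a0.
have b'0 : 0 < b' by rewrite lt_max b0.
have S m (f : R[i] -> R[i]) : voiculescu_transform m a b f -> voiculescu_transform m a' b' f.
  by apply: voiculescu_transformS; rewrite // ?ge_min ?le_max lexx.
have S1 m (f : R[i] -> R[i]) : voiculescu_transform m a1 b1 f -> voiculescu_transform m a' b' f.
  by apply: voiculescu_transformS; rewrite // ?ge_min ?le_max lexx orbT.
have [b2 [b'b2 e2]] := voiculescu_transform_uniq b'0 (S _ _ Vmu) (S1 _ _ Vmu1).
have [b3 [b'b3 e3]] := voiculescu_transform_uniq b'0 (S _ _ Vnu) (S1 _ _ Vnu1).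
have b20 : 0 < b2 by exact: lt_le_trans b'b2.
have b30 : 0 < b3 by exact: lt_le_trans b'b3.
have b'b : b' <= Num.max b2 b3 by rewrite le_max b'b2.
exists a', (Num.max b2 b3), psi; split => //; first by rewrite lt_max b20.
  by apply: (voiculescu_transformS _ (lexx a') b'b) => //; exact: S.
apply: (@eq_voiculescu_transform _ _ _ (phi \+ psi)); last first.
  by apply: (voiculescu_transformS _ (lexx a') b'b) => //; exact: S.
move=> z zc /=; rewrite e3; last by apply: truncated_coneS zc; rewrite // le_max lexx orbT.
rewrite -e2; last by apply: truncated_coneS zc; rewrite // le_max lexx.
by rewrite -natr1 mulrDl mul1r.
Qed.

End voiculescu.

(** * Asymptotic expansions at zero *)

Section vanishes.
Context {R : realType}.
Local Open Scope complex_scope.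
Implicit Types (f g : R -> R[i]) (k l : nat).

(* f e = O(e ^+ k) as e -> 0+; the values at e <= 0 are irrelevant. *)
Definition vanishes k f : Prop :=
  exists C d : R, 0 < d /\ forall e, 0 < e < d -> `|f e| <= (C * e ^+ k)%:C.

Lemma lecD (x y : R[i]) (a b : R) : `|x| <= a%:C -> `|y| <= b%:C -> `|x + y| <= (a + b)%:C.
Proof.
by move=> xa yb; apply: le_trans (ler_normD _ _) _; rewrite rmorphD /= lerD.
Qed.

Lemma lecM (x y : R[i]) (a b : R) : `|x| <= a%:C -> `|y| <= b%:C -> `|x * y| <= (a * b)%:C.
Proof. by move=> xa yb; rewrite normrM rmorphM /= ler_pM. Qed.

Lemma vanishes_near (d : R) k f g : 0 < d -> (forall e, 0 < e < d -> f e = g e) ->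
  vanishes k f -> vanishes k g.
Proof.
move=> d0 fg [C [d' [d'0 h]]]; exists C, (Num.min d d'); split; first by rewrite lt_min d0.
by move=> e /andP[e0]; rewrite lt_min => /andP[ed ed']; rewrite -fg ?e0// h// e0.
Qed.

Lemma eq_vanishes k f g : (forall e, 0 < e -> f e = g e) -> vanishes k f -> vanishes k g.
Proof. by move=> fg; apply: (@vanishes_near 1) => // e /andP[/fg]. Qed.

Lemma vanishesD k f g : vanishes k f -> vanishes k g -> vanishes k (fun e => f e + g e).
Proof.
move=> [C [d [d0 h]]] [C' [d' [d'0 h']]].
exists (C + C'), (Num.min d d'); split; first by rewrite lt_min d0.
move=> e /andP[e0]; rewrite lt_min => /andP[ed ed']; rewrite mulrDl.
by apply: lecD; [apply: h; rewrite e0|apply: h'; rewrite e0].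
Qed.

Lemma vanishesM k l f g : vanishes k f -> vanishes l g -> vanishes (k + l) (fun e => f e * g e).
Proof.
move=> [C [d [d0 h]]] [C' [d' [d'0 h']]].
exists (C * C'), (Num.min d d'); split; first by rewrite lt_min d0.
move=> e /andP[e0]; rewrite lt_min => /andP[ed ed']; rewrite exprD mulrACA.
by apply: lecM; [apply: h; rewrite e0|apply: h'; rewrite e0].
Qed.

Lemma vanishesN k f : vanishes k f -> vanishes k (fun e => - f e).
Proof. by move=> [C [d [d0 h]]]; exists C, d; split => // e /h; rewrite normrN. Qed.

Lemma vanishesB k f g : vanishes k f -> vanishes k g -> vanishes k (fun e => f e - g e).
Proof. by move=> kf /vanishesN; exact: vanishesD. Qed.

Lemma vanishes_cst (c : R[i]) : vanishes 0 (fun=> c).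
Proof.
exists (complex.Re `|c|), 1; split=> // e _.
by rewrite expr0 mulr1 RRe_real// normr_real.
Qed.

Lemma vanishesZ k (c : R[i]) f : vanishes k f -> vanishes k (fun e => c * f e).
Proof. by move=> kf; rewrite -[k]add0n; apply: vanishesM => //; exact: vanishes_cst. Qed.

Lemma vanishes_weak k l f : (l <= k)%N -> vanishes k f -> vanishes l f.
Proof.
move=> lk [C [d [d0 h]]]; exists `|C|, (Num.min d 1); split; first by rewrite lt_min d0 ltr01.
move=> e /andP[e0]; rewrite lt_min => /andP[ed e1]; apply: le_trans (h e _) _; first by rewrite e0.
rewrite lecR; apply: le_trans (ler_wpM2r _ (ler_norm C)) _; first by rewrite exprn_ge0// ltW.
by rewrite ler_wpM2l// ler_wiXn2l// ltW.
Qed.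

Lemma vanishes_conj k f : vanishes k f -> vanishes k (fun e => @conjc R (f e)).
Proof. by move=> [C [d [d0 h]]]; exists C, d; split => // e /h; rewrite normcJ. Qed.

Lemma vanishes0 k : vanishes k (fun=> 0).
Proof.
by exists 0, 1; split=> // e _; rewrite normr0 mul0r.
Qed.

Lemma vanishes_sum k (I : Type) (r : seq I) (F : I -> R -> R[i]) :
  (forall i, vanishes k (F i)) -> vanishes k (fun e => \sum_(i <- r) F i e).
Proof.
move=> Fk; elim: r => [|i r IH].
  by apply: eq_vanishes (vanishes0 k) => e _; rewrite big_nil.
by apply: eq_vanishes (vanishesD (Fk i) IH) => e _; rewrite big_cons.
Qed.

Lemma vanishesX k n f : vanishes k f -> vanishes (k * n) (fun e => f e ^+ n).
Proof.
move=> kf; elim: n => [|n IH]; first by rewrite muln0; exact: vanishes_cst.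
by rewrite mulnS; apply: eq_vanishes (vanishesM kf IH) => e _; rewrite exprS.
Qed.

Lemma vanishes_div k l f : vanishes (k + l) f -> vanishes k (fun e => f e / e%:C ^+ l).
Proof.
move=> [C [d [d0 h]]]; exists C, d; split=> // e ed; have /andP[e0 _] := ed.
have el0 : 0 < e ^+ l by rewrite exprn_gt0.
rewrite normrM normfV -rmorphXn /= (_ : `|(e ^+ l)%:C| = (e ^+ l)%:C); last first.
  by rewrite ger0_norm// ler0c ltW.
rewrite ler_pdivrMr; last by rewrite -[0]/(0%:C) ltcR.
by rewrite -rmorphM /= -mulrA -exprD h.
Qed.

Lemma vanishes_scale k (t : R) f : 0 < t -> vanishes k f -> vanishes k (fun e => f (t * e)).
Proof.
move=> t0 [C [d [d0 h]]]; exists (C * t ^+ k), (d / t); split; first by rewrite divr_gt0.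
move=> e /andP[e0 ed]; rewrite -mulrA -exprMn h// mulr_gt0//= mulrC.
by rewrite -ltr_pdivlMr.
Qed.

Lemma vanishes_small (f : R -> R[i]) (c : R) : 0 < c -> vanishes 1 f ->
  exists2 d : R, 0 < d & forall e, 0 < e < d -> `|f e| <= c%:C.
Proof.
move=> c0 [C [d [d0 h]]]; have K0 : 0 < `|C| + 1 by rewrite ltr_wpDl.
exists (Num.min d (c / (`|C| + 1))); first by rewrite lt_min d0 divr_gt0.
move=> e /andP[e0]; rewrite lt_min => /andP[ed eK]; apply: le_trans (h e _) _; first by rewrite e0.
rewrite lecR expr1; apply: le_trans (_ : (`|C| + 1) * e <= _).
  by rewrite ler_wpM2r ?ltW//; have := ler_norm C; lra.
by rewrite mulrC -ler_pdivlMr// ltW.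
Qed.

Lemma vanishes_inv1B f : vanishes 1 f -> vanishes 0 (fun e => (1 - f e)^-1).
Proof.
move=> /(@vanishes_small _ 2^-1) []; first by rewrite invr_gt0.
move=> d d0 h; exists 2, d; split=> // e /h fe; rewrite expr0 mulr1.
have le2 : (2^-1)%:C <= `|1 - f e|.
  apply: le_trans (lerB_dist _ _).
  rewrite normr1 lerBrDr; apply: le_trans (lerD (lexx _) fe) _.
  by rewrite -rmorphD /= (_ : 2^-1 + 2^-1 = 1)//; lra.
rewrite normfV -[2]invrK fmorphV /= lef_pV2 ?posrE//.
- by apply: lt_le_trans le2; rewrite -[0]/(0%:C) ltcR invr_gt0.
- by rewrite -[0]/(0%:C) ltcR invr_gt0.
Qed.

(** Let $p,q$ be the truncated polynomials in $b$ and $r$ the truncation of $pq$. Then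
    $AB-r=(A-p)B+p(B-q)+(pq-r)$, and $pq-r$ has no coefficient below order $n$. *)
Lemma vanishes_cauchy n (b A B : R -> R[i]) (al be : nat -> R[i]) : vanishes 1 b ->
  vanishes n (fun e => A e - \sum_(i < n) al i * b e ^+ i) ->
  vanishes n (fun e => B e - \sum_(i < n) be i * b e ^+ i) ->
  vanishes n (fun e => A e * B e -
    \sum_(i < n) (\sum_(j < i.+1) al j * be (i - j)%N) * b e ^+ i).
Proof.
move=> b1 hA hB.
pose p := \poly_(i < n) al i; pose q := \poly_(i < n) be i.
have O0 (P : {poly R[i]}) : vanishes 0 (fun e => P.[b e]).
  apply: eq_vanishes (@vanishes_sum _ _ (index_enum 'I_(size P)) (fun i e => P`_i * b e ^+ i) _) => [e _|i].
    by rewrite horner_coef.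
  apply: vanishesZ; apply: (@vanishes_weak (1 * i)) => //; exact: vanishesX.
have On (P : {poly R[i]}) : (forall i, (i < n)%N -> P`_i = 0) -> vanishes n (fun e => P.[b e]).
  move=> P0; apply: eq_vanishes (@vanishes_sum _ _ (index_enum 'I_(size P)) (fun i e => P`_i * b e ^+ i) _) => [e _|i].
    by rewrite horner_coef.
  have [/P0 ->|ni] := ltnP i n; first by apply: eq_vanishes (vanishes0 n) => e _; rewrite mul0r.
  by apply: vanishesZ; apply: (@vanishes_weak (1 * i)); [rewrite mul1n|exact: vanishesX].
have pE e : p.[b e] = \sum_(i < n) al i * b e ^+ i by rewrite horner_poly.
have qE e : q.[b e] = \sum_(i < n) be i * b e ^+ i by rewrite horner_poly.
pose r := \poly_(i < n) (\sum_(j < i.+1) al j * be (i - j)%N).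
have pqr : vanishes n (fun e => (p * q - r).[b e]).
  apply: On => i iN; rewrite coefB coefM coef_poly iN; apply/eqP; rewrite subr_eq0; apply/eqP.
  apply: eq_bigr => j _; have jN : (j < n)%N by apply: leq_ltn_trans iN; rewrite -ltnS.
  by rewrite !coef_poly jN (leq_ltn_trans (leq_subr _ _) iN).
have B0 : vanishes 0 B.
  apply: eq_vanishes (vanishesD (vanishes_weak (leq0n n) hB) (O0 q)) => e _.
  by rewrite qE subrK.
have h1 : vanishes n (fun e => (A e - p.[b e]) * B e).
  by rewrite -[n]addn0; apply: vanishesM => //; apply: eq_vanishes hA => e _; rewrite pE.
have h2 : vanishes n (fun e => p.[b e] * (B e - q.[b e])).
  by rewrite -[n]add0n; apply: vanishesM; [exact: O0|apply: eq_vanishes hB => e _; rewrite qE].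
apply: eq_vanishes (vanishesD (vanishesD h1 h2) pqr) => e _.
rewrite hornerD hornerN hornerM (_ : r.[b e] = \sum_(i < n)
  (\sum_(j < i.+1) al j * be (i - j)%N) * b e ^+ i); last by rewrite horner_poly.
by move: p.[b e] q.[b e] => P Q; ring.
Qed.

End vanishes.

(** * Expansion of the Voiculescu transform *)

Section support.
Context {R : realType} (mu : probability (measurableTypeR R) R).
Local Open Scope complex_scope.
Variable r : R.
Hypothesis r0 : 0 < r.
Hypothesis mur : mu (~` `[- r, r]%classic) = 0%E.

Let D : set (measurableTypeR R) := `[- r, r]%classic.
(** The variable cut to $0$ off the support: it agrees with $x$ almost everywhere and is bounded by
    $r$ everywhere. *)
Let t : R -> R := (fun x => x) \_ D.

Let mD : measurable D. Proof. exact: measurable_itv. Qed.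

Let mt : measurable_fun setT t.
Proof. by apply/(measurable_restrict _ mD) => //; rewrite setTI; exact: measurable_funTS. Qed.

Let tr x : `|t x| <= r.
Proof.
rewrite /t patchE; case: ifPn => [|_]; last by rewrite normr0 ltW.
by rewrite inE /D/= in_itv/= ler_norml.
Qed.

Lemma Rintegral_supp (h : R -> R) : measurable_fun setT h ->
  \int[mu]_x h x = \int[mu]_x h (t x).
Proof.
move=> mh; rewrite /Rintegral.
rewrite (integral_null_compl mD mur (f := EFin \o h)); last exact: measurableT_comp.
rewrite (integral_null_compl mD mur (f := EFin \o (h \o t))); last first.
  by apply: measurableT_comp => //; exact: measurableT_comp.
congr fine; apply: eq_integral => x xD; rewrite /= /t patchE xD.
by [].
Qed.

Lemma cint_norm (f : R -> R[i]) (K : R) : cintegrable mu f ->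
  (forall x, `|f x| <= K%:C) -> `|cint mu f| <= (2 * K)%:C.
Proof.
move=> [fr fi] fK.
have bnd (h : R -> R) : mu.-integrable setT (EFin \o h) -> (forall x, `|h x| <= K) ->
    `|\int[mu]_x h x| <= K.
  move=> hi hK; apply: le_trans (le_normr_Rintegral measurableT hi) _.
  have -> : K = \int[mu]_x (fun=> K) x.
    rewrite Rintegral_cst//.
    have -> : fine (mu [set: measurableTypeR R]) = 1 := congr1 fine (probability_setT mu).
    by rewrite mulr1.
  apply: le_Rintegral => //; last exact: integrable_cstR.
  exact: integrable_norm.
have ReK x : `|complex.Re (f x)| <= K.
  by rewrite -lecR; apply: le_trans (fK x); exact: normc_ge_Re.
have ImK x : `|complex.Im (f x)| <= K.
  rewrite -lecR; apply: le_trans (fK x).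
  rewrite -normrN -ReiNIm; apply: le_trans (normc_ge_Re _) _.
  by rewrite normrM (_ : `|'i| = 1) ?mulr1// normc_def /= expr0n expr1n add0r sqrtr1.
rewrite mulrDl mul1r (complexE (cint mu f)); apply: lecD.
  by rewrite normc_def /= expr0n addr0 sqrtr_sqr lecR bnd.
rewrite normrM (_ : `|'i| = 1) ?mul1r; last by rewrite normc_def /= expr0n expr1n add0r sqrtr1.
by rewrite normc_def /= expr0n addr0 sqrtr_sqr lecR bnd.
Qed.

(** With $b=1/w$, the finite geometric sum leaves the remainder $t^nb^{n+1}/(1-tb)$ in $1/(w-t)$,
    and the bound on $b$ gives $|tb|\le1/2$. *)
Lemma cauchy_transform_expansion n : exists K : R, forall w,
  0 < complex.Im w -> `|w^-1| <= ((2 * r)^-1)%:C ->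
  `|cauchy_transform mu w - \sum_(k < n) (moment mu k)%:C * w^-1 ^+ k.+1|
    <= K%:C * `|w^-1| ^+ n.+1.
Proof.
(* The inner factor 2 bounds $|1-tb|^{-1}$; the outer one comes from [cint_norm], which bounds real
   and imaginary parts separately. *)
exists (2 * (2 * r ^+ n)) => w w0 b2; set b := w^-1 in b2 *.
have wn0 : w != 0 by apply: contraTneq w0 => ->; rewrite ltxx.
pose g x : R[i] := resolvent w (t x).
have mhr := measurable_Re_resolvent w0; have mhi := measurable_Im_resolvent w0.
have gi : cintegrable mu g.
  split.
    apply: (@bounded_integrable _ mu _ (complex.Im w)^-1); last by move=> x; exact: Re_resolvent_le.
    exact: (measurableT_comp mhr mt).
  apply: (@bounded_integrable _ mu _ (complex.Im w)^-1); last by move=> x; exact: Im_resolvent_le.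
  exact: (measurableT_comp mhi mt).
have gG : cint mu g = cauchy_transform mu w.
  by rewrite cauchy_transformE /cint (Rintegral_supp mhr) (Rintegral_supp mhi).
pose f x : R[i] := g x - \sum_(k < n) b ^+ k.+1 * (t x ^+ k)%:C.
have tk k : cintegrable mu (fun x => (t x ^+ k)%:C) /\
    cint mu (fun x => (t x ^+ k)%:C) = (moment mu k)%:C.
  have mk : measurable_fun setT (fun x => t x ^+ k).
    by apply: (@measurableT_comp _ _ _ _ _ _ (fun x : R => x ^+ k)) => //; exact: exprn_measurable.
  split.
    split; last exact: integrable_cstR.
    by apply: (@bounded_integrable _ mu _ (r ^+ k)) => // x; rewrite normrX lerXn2r ?nnegrE ?(ltW r0).
  rewrite /cint /= Rintegral_cst// mul0r /moment.
  by rewrite (Rintegral_supp (exprn_measurable k)).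
have ti k : cintegrable mu (fun x => - b ^+ k.+1 * (t x ^+ k)%:C).
  by apply: cintegrableZ; have [] := tk k.
have si := cintegrable_sum (index_enum 'I_n) (fun k : 'I_n => ti k).
have fE x : f x = g x + \sum_(k < n) - b ^+ k.+1 * (t x ^+ k)%:C.
  by rewrite /f -sumrN; congr (_ + _); apply: eq_bigr => k _; rewrite mulNr.
have fi : cintegrable mu f by rewrite (funext fE); exact: cintegrableD.
have -> : cauchy_transform mu w - \sum_(k < n) (moment mu k)%:C * b ^+ k.+1 = cint mu f.
  rewrite (funext fE) cintD// gG cint_sum// -sumrN; congr (_ + _); apply: eq_bigr => k _.
  by have [t1 t2] := tk k; rewrite cintZ// t2 mulNr mulrC.
have bE : `|b| = (complex.Re `|b|)%:C by rewrite RRe_real// normr_real.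
rewrite bE -rmorphXn -rmorphM /= -!mulrA; apply: cint_norm => // x.
have tb : `|(t x)%:C * b| <= (2^-1)%:C.
  rewrite normrM (_ : `|(t x)%:C| = `|t x|%:C); last by rewrite normc_def /= expr0n addr0 sqrtr_sqr.
  have trC : `|t x|%:C <= r%:C by rewrite lecR; exact: tr.
  apply: le_trans (ler_pM _ _ trC b2) _ => //; first by rewrite ler0c.
  by rewrite -rmorphM /= lecR invfM mulrCA divff ?mulr1// gt_eqF.
have le2 : (2^-1)%:C <= `|1 - (t x)%:C * b|.
  apply: le_trans (lerB_dist _ _).
  rewrite normr1 lerBrDr; apply: le_trans (lerD (lexx _) tb) _.
  by rewrite -rmorphD /= (_ : 2^-1 + 2^-1 = 1)//; lra.
have h20 : 0 < (2^-1 : R)%:C by rewrite -[0]/(0%:C) ltcR invr_gt0.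
have nz : 1 - (t x)%:C * b != 0.
  by rewrite -normr_gt0; exact: lt_le_trans le2.
have -> : f x = (t x ^+ n)%:C * b ^+ n.+1 * (1 - (t x)%:C * b)^-1.
  apply: (mulIf nz); rewrite mulfVK//.
  have gx : g x * (1 - (t x)%:C * b) = b.
    have wt := subRI_neq0 (t x) w0.
    by rewrite /g /resolvent /b; field; rewrite wt wn0.
  rewrite /f mulrBl gx.
  have -> : \sum_(k < n) b ^+ k.+1 * (t x ^+ k)%:C = b * \sum_(k < n) ((t x)%:C * b) ^+ k.
    rewrite big_distrr /=; apply: eq_bigr => k _.
    by rewrite exprS exprMn rmorphXn /=; ring.
  have := subrX1 ((t x)%:C * b) n; set S := \sum_(k < n) _ ^+ k => hS.
  have -> : b - b * S * (1 - (t x)%:C * b) = b * (1 + ((t x)%:C * b - 1) * S) by ring.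
  by rewrite -hS exprMn rmorphXn /= exprS; ring.
have inv2 : `|(1 - (t x)%:C * b)^-1| <= 2%:C.
  by rewrite normfV -[2]invrK fmorphV /= lef_pV2 ?posrE// (lt_le_trans h20).
have tn : `|(t x ^+ n)%:C| <= (r ^+ n)%:C.
  rewrite normc_def /= expr0n addr0 sqrtr_sqr lecR normrX.
  by rewrite lerXn2r ?nnegrE ?(ltW r0).
have bn : `|b ^+ n.+1| <= (complex.Re `|b| ^+ n.+1)%:C by rewrite normrX bE rmorphXn.
by rewrite mulrC; apply: lecM => //; apply: lecM.
Qed.

End support.


Section expansion.
Context {R : realType}.
Local Open Scope complex_scope.

(* The points (ray e)^-1 = i / e go to infinity along the imaginary axis as e -> 0+. *)
Definition ray (e : R) : R[i] := 0 +i* (- e).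

Lemma norm_ray e : 0 <= e -> `|ray e| = e%:C.
Proof. by move=> e0; rewrite normc_def /= expr0n add0r sqrrN sqrtr_sqr ger0_norm. Qed.

Lemma rayV e : e != 0 -> (ray e)^-1 = 0 +i* e^-1.
Proof.
move=> e0; apply: (mulfI (_ : ray e != 0)); first by rewrite eq_complex /= oppr_eq0 (negPf e0) andbF.
rewrite mulfV; last by rewrite eq_complex /= oppr_eq0 (negPf e0) andbF.
by apply/eqP; rewrite eq_complex /= !mul0r !mulr0 mulNr mulfV// sub0r opprK addr0 !eqxx.
Qed.

Lemma ray_neq0 e : e != 0 -> ray e != 0.
Proof. by move=> e0; rewrite eq_complex /= oppr_eq0 (negPf e0) andbF. Qed.

Lemma vanishes_ray : vanishes 1 ray.
Proof.
exists 1, 1; split=> // e /andP[e0 _].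
by rewrite (norm_ray (ltW e0)) mul1r expr1 lexx.
Qed.

Lemma normc_ge_Im (z : R[i]) : `|complex.Im z|%:C <= `|z|.
Proof. by rewrite normc_def lecR -sqrtr_sqr ler_wsqrtr// lerDr sqr_ge0. Qed.

Fixpoint horner_seq (ks : seq R) (a : R[i]) : R[i] :=
  if ks is k :: ks' then k%:C + a * horner_seq ks' a else 0.

(* The coefficients of horner_seq ks a as a power series in b, where
   a = b * \sum_i m i * b ^+ i. *)
Fixpoint horner_coefs (m : nat -> R) (ks : seq R) (i : nat) : R :=
  if ks is k :: ks' then
    if i is i'.+1 then \sum_(j <- iota 0 i) m j * horner_coefs m ks' (i' - j) else k
  else 0.

Definition shift_coefs (m : nat -> R) (i : nat) : R := if i is i'.+1 then m i' else 0.

(** Induction along the Horner scheme, each step being one Cauchy product with the expansion of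
    $a$. *)
Lemma horner_seq_expansion n (m : nat -> R) (ks : seq R) (a b : R -> R[i]) :
  vanishes 1 b ->
  vanishes n.+1 (fun e => a e - \sum_(i < n.+1) (shift_coefs m i)%:C * b e ^+ i) ->
  vanishes n.+1 (fun e => horner_seq ks (a e) -
    \sum_(i < n.+1) (horner_coefs m ks i)%:C * b e ^+ i).
Proof.
move=> b1 ha; elim: ks => [|k ks IH].
  apply: eq_vanishes (vanishes0 n.+1) => e _ /=.
  by rewrite big1 ?subr0// => i _; rewrite mul0r.
have := @vanishes_cauchy _ n.+1 b a _ (fun i => (shift_coefs m i)%:C)
  (fun i => (horner_coefs m ks i)%:C) b1 ha IH.
apply: eq_vanishes => e _ /=; rewrite !big_ord_recl big_ord0 addr0 !mul0r add0r mulr1.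
rewrite opprD addrA [k%:C + _]addrC addrK; congr (_ - _); apply: eq_bigr => i _.
congr (_ * _); rewrite big_ord_recl /= mul0r add0r rmorph_sum /=.
rewrite (_ : 0%N :: iota 1 i = index_iota 0 i.+1); last by rewrite /index_iota subn0.
by rewrite big_mkord; apply: eq_bigr => j _; rewrite rmorphM.
Qed.

(** The R-transform relation up to order six: $R(G(w))+1/G(w)=w$ means
    $G\,R(G)=wG-1=\sum_{i\ge1}m_iw^{-i}$. The leading $0$ of the list produces the factor $G$; at
    $i=0$ the coefficient is $0$, not $m_0$. *)
Lemma horner_coefs_cumulants (m kappa : nat -> R) : moment_cumulant m kappa -> m 0%N = 1 ->
  forall i, (0 < i < 7)%N ->
  horner_coefs m [:: 0; kappa 1%N; kappa 2%N; kappa 3%N; kappa 4%N; kappa 5%N; kappa 6%N] i = m i.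
Proof.
move=> mk m0; have [h1 h2 h3 h4 [h5 h6]] := moment_cumulant6 mk.
case=> [|[|[|[|[|[|[|i]]]]]]] // _;
  rewrite /=; do 8 rewrite ?big_cons ?big_nil /=; rewrite m0.
- by rewrite h1; ring.
- by rewrite h2 h1; ring.
- by rewrite h3 h2 h1; ring.
- by rewrite h4 h3 h2 h1; ring.
- by rewrite h5 h4 h3 h2 h1; ring.
- by rewrite h6 h5 h4 h3 h2 h1; ring.
Qed.

Section voiculescu_expansion.
Variables (mu : probability (measurableTypeR R) R) (r a b : R).
Variables (phi : R[i] -> R[i]) (kappa : nat -> R).
Hypotheses (r0 : 0 < r) (mur : mu (~` `[- r, r]%classic) = 0%E).
Hypotheses (a0 : 0 < a) (b0 : 0 < b) (Vphi : voiculescu_transform mu a b phi).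
Hypothesis mk : moment_cumulant (moment mu) kappa.

Let m := moment mu.
(* F_mu (w e) = (ray e)^-1. *)
Let w e := (ray e)^-1 + phi (ray e)^-1.

Let m0 : m 0%N = 1.
Proof.
rewrite /m /moment (@eq_Rintegral _ _ _ _ _ (fun=> 1))// Rintegral_cst// mul1r.
exact: (congr1 fine (probability_setT mu)).
Qed.

Lemma ray_cone e : 0 < e < b^-1 -> truncated_cone a b (ray e)^-1.
Proof.
move=> /andP[e0 eb]; rewrite rayV ?gt_eqF//; split => /=.
  by rewrite -[b]invrK ltf_pV2 ?posrE ?invr_gt0.
by rewrite normr0 mulr_gt0 ?invr_gt0.
Qed.

Let w_near (c : R) : 0 < c -> exists2 d : R, 0 < d & forall e, 0 < e < d ->
  [/\ 0 < complex.Im (w e), cauchy_transform mu (w e) = ray e & `|(w e)^-1| <= c%:C].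
Proof.
move=> c0; have [C hC] := voiculescu_transform_Im c^-1 Vphi.
(* [C] may be negative or zero; the maximum with 1 has a positive inverse. *)
pose C' := Num.max C 1; have C'0 : 0 < C' by rewrite lt_max ltr01 orbT.
exists (Num.min b^-1 C'^-1); first by rewrite lt_min !invr_gt0 b0.
move=> e /andP[e0]; rewrite lt_min => /andP[eb eC].
have zc : truncated_cone a b (ray e)^-1 by apply: ray_cone; rewrite e0.
have wc : c^-1 < complex.Im (w e).
  apply: hC => //; rewrite rayV ?gt_eqF//=.
  apply: (@le_lt_trans _ _ C'); first by rewrite le_max lexx.
  by rewrite -[C']invrK ltf_pV2 ?posrE ?invr_gt0.
have w0 : 0 < complex.Im (w e) by apply: lt_trans wc; rewrite invr_gt0.
have [l [M [_ _ _ /(_ _ zc) [_ Fw]]]] := Vphi.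
split => //; first by have := congr1 GRing.inv Fw; rewrite /reciprocal_cauchy !invrK.
have cV : c%:C = ((c^-1)%:C)^-1 by rewrite fmorphV invrK.
rewrite normfV cV lef_pV2 ?posrE.
- apply: le_trans (normc_ge_Im _); rewrite lecR; apply: le_trans (ler_norm _).
  exact: ltW.
- rewrite normr_gt0; apply: contraTneq w0 => ->; rewrite ltxx//.
- by rewrite -[0]/(0%:C) ltcR invr_gt0.
Qed.

(** Recovers $F_\mu(w)\sim w$ along the ray: the expansion to first order gives
    $|\mathrm{ray}(e)-1/w|\le K|w|^{-2}\le|w|^{-1}/2$, so that $1/w$ is comparable to $e$. *)
Let w_equiv : exists2 d : R, 0 < d & forall e, 0 < e < d ->
  `|(w e)^-1| <= (2 * e)%:C /\ (e / 2)%:C <= `|(w e)^-1|.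
Proof.
have [K hK] := cauchy_transform_expansion r0 mur 1.
pose K' := `|K| + 1; have K'0 : 0 < K' by rewrite ltr_wpDl.
(* The first bound makes the expansion valid, the second makes its error at most half of $|1/w|$. *)
pose c := Num.min (2 * r)^-1 (2 * K')^-1.
have c0 : 0 < c by rewrite lt_min !invr_gt0 !mulr_gt0.
have [d d0 hd] := w_near c0; exists d => // e ed; have /andP[e0 _] := ed.
have [w0 Gw wc] := hd e ed.
have wr : `|(w e)^-1| <= ((2 * r)^-1)%:C by apply: le_trans wc _; rewrite lecR ge_min lexx.
have wK : `|(w e)^-1| <= ((2 * K')^-1)%:C by apply: le_trans wc _; rewrite lecR ge_min lexx orbT.
have := hK _ w0 wr; rewrite big_ord1 Gw -/m m0 mul1r expr1.
set B := (w e)^-1 in wK *; set N := complex.Re `|B|.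
have BE : `|B| = N%:C by rewrite RRe_real// normr_real.
have N0 : 0 <= N by rewrite -ler0c -BE.
have rE := norm_ray (ltW e0).
move: wK; rewrite BE -rmorphXn -rmorphM /= !lecR => wK.
have KN : K * N ^+ 2 <= N / 2.
  have : K' * N <= 2^-1.
    by rewrite -ler_pdivlMl// -invfM mulrC.
  have : K <= K' by rewrite /K'; have := ler_norm K; lra.
  nra.
move=> h; have {}h : `|ray e - B| <= (N / 2)%:C.
  by rewrite -[X in X <= _]/((Normc.normc (ray e - B))%:C) lecR (le_trans h).
have h1 : `|B| <= (e + N / 2)%:C.
  rewrite (_ : B = ray e + (- (ray e - B))); last by ring.
  by apply: lecD; rewrite ?normrN// rE.
have h2 : `|ray e| <= (N + N / 2)%:C.
  rewrite (_ : ray e = B + (ray e - B)); last by ring.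
  by apply: lecD; rewrite ?BE.
by move: h1 h2; rewrite BE rE !lecR => h1 h2; split; lra.
Qed.

Let vanishes_w : vanishes 1 (fun e => (w e)^-1).
Proof.
have [d d0 h] := w_equiv; exists 2, d; split=> // e /h [].
by rewrite expr1.
Qed.

Let vanishes_wV : vanishes 0 (fun e => e%:C / (w e)^-1).
Proof.
have [d d0 h] := w_equiv; exists 2, d; split=> // e ed; have [_ h2] := h e ed.
have /andP[e0 _] := ed; rewrite expr0 mulr1 normrM normfV.
have B0 : 0 < `|(w e)^-1|.
  by apply: lt_le_trans h2; rewrite -[0]/(0%:C) ltcR divr_gt0.
rewrite ler_pdivrMr// (_ : `|e%:C| = e%:C); last by rewrite ger0_norm// ler0c ltW.
apply: le_trans (_ : 2%:C * (e / 2)%:C <= _); last by rewrite ler_wpM2l// ler0c.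
by rewrite -rmorphM lecR /=; lra.
Qed.

Let cauchy_vanishes n :
  vanishes n.+1 (fun e => ray e - \sum_(k < n) (m k)%:C * (w e)^-1 ^+ k.+1).
Proof.
have [K hK] := cauchy_transform_expansion r0 mur n.
have r20 : 0 < (2 * r)^-1 by rewrite invr_gt0 mulr_gt0.
have [d d0 hd] := w_near r20.
have [C [d' [d'0 hd']]] := vanishesX n.+1 vanishes_w.
exists (`|K| * C), (Num.min d d'); split; first by rewrite lt_min d0.
move=> e /andP[e0]; rewrite lt_min => /andP[ed ed'].
have [|w0 Gw wr] := hd e; first by rewrite e0.
have := hK _ w0 wr; rewrite Gw => h; apply: le_trans h _.
rewrite -normrX -mulrA rmorphM /=; apply: le_trans (_ : `|K|%:C * `|(w e)^-1 ^+ n.+1| <= _).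
  by rewrite ler_wpM2r// lecR ler_norm.
rewrite ler_wpM2l// ?ler0c//.
by have := hd' e; rewrite mul1n; apply; rewrite e0.
Qed.

(** With $a=\mathrm{ray}(e)=G(w)$ and $B=1/w$, one has $\varphi(1/a)-R(a)=(a-B-BaR(a))/(Ba)$.
    Division by $Ba$ costs two orders, so the numerator is needed up to $O(e^8)$. *)
Theorem voiculescu_expansion :
  vanishes 6 (fun e => phi (ray e)^-1 - \sum_(k < 6) (kappa k.+1)%:C * ray e ^+ k).
Proof.
pose ks := [:: kappa 1%N; kappa 2%N; kappa 3%N; kappa 4%N; kappa 5%N; kappa 6%N].
pose B e := (w e)^-1.
have hsE e : horner_seq ks (ray e) = \sum_(k < 6) (kappa k.+1)%:C * ray e ^+ k.
  rewrite !big_ord_recl big_ord0 /= /bump /=; ring.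
have ray7 : vanishes 7 (fun e => ray e - \sum_(i < 7) (shift_coefs m i)%:C * B e ^+ i).
  apply: eq_vanishes (cauchy_vanishes 6) => e _.
  by rewrite [in RHS]big_ord_recl /= mul0r add0r.
have := horner_seq_expansion (0 :: ks) vanishes_w ray7.
move=> hs; have {}hs : vanishes 8 (fun e => B e *
    (ray e * horner_seq ks (ray e) - \sum_(k < 6) (m k.+1)%:C * B e ^+ k.+1)).
  apply: (vanishesM (k := 1) (l := 7) vanishes_w); apply: eq_vanishes hs => e _.
  rewrite (_ : horner_seq (0 :: ks) (ray e) = ray e * horner_seq ks (ray e)); last exact: add0r.
  congr (_ - _).
  rewrite big_ord_recl [horner_coefs _ _ _]/(0 : R) mul0r add0r; apply: eq_bigr => i _.
  have iH : (0 < i.+1 < 7)%N by rewrite /= ltnS ltn_ord.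
  congr (_%:C * _); exact: (horner_coefs_cumulants mk m0 iH).
have ray8 := cauchy_vanishes 7.
have key : vanishes 8 (fun e => ray e - B e - B e * (ray e * horner_seq ks (ray e))).
  apply: eq_vanishes (vanishesB ray8 hs) => e _.
  rewrite (_ : \sum_(k < 7) (m k)%:C * (w e)^-1 ^+ k.+1 =
    B e + B e * \sum_(k < 6) (m k.+1)%:C * B e ^+ k.+1); first by rewrite /B; ring.
  rewrite big_ord_recl big_distrr m0 mul1r; congr (_ + _); apply: eq_bigr => k _.
  by rewrite /= /bump /= add1n [in LHS]exprS -/(B e) mulrCA.
have rayV0 : vanishes 0 (fun e => e%:C / ray e).
  exists 1, 1; split=> // e /andP[e0 _]; rewrite normrM normfV (norm_ray (ltW e0)).
  have en0 : e%:C != 0 by rewrite eq_complex /= (gt_eqF e0).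
  rewrite (_ : `|e%:C| = e%:C); last by rewrite ger0_norm// ler0c ltW.
  by rewrite mulfV// expr0 mulr1 lexx.
have [d d0 hd] := w_near ltr01.
(* Dividing by $e^2$ and multiplying by the bounded factors $e/B$ and $e/\mathrm{ray}(e)$ amounts to
   division by $B\,\mathrm{ray}(e)$. *)
have := vanishesM (vanishesM (vanishes_div (k := 6) (l := 2) key) vanishes_wV) rayV0.
apply: (@vanishes_near _ d) => // e ed; have /andP[e0 _] := ed.
have [w0 _ _] := hd e ed.
have wn0 : w e != 0 by apply: contraTneq w0 => ->; rewrite ltxx.
have rn0 : ray e != 0 by apply: ray_neq0; rewrite gt_eqF.
have en0 : e%:C != 0 by rewrite eq_complex /= (gt_eqF e0).
rewrite -hsE.
have -> : phi (ray e)^-1 = w e - (ray e)^-1 by rewrite /w addrC addKr.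
by rewrite /B; field; rewrite wn0 rn0 en0.
Qed.

End voiculescu_expansion.
End expansion.

(** * Positivity of the Hankel matrix *)

Section hankel_positivity.
Context {R : realType}.
Local Open Scope complex_scope.
Local Notation cj := (@conjc R).

Lemma cjD (y z : R[i]) : cj (y + z) = cj y + cj z.
Proof. exact: (rmorphD (@conjc R)). Qed.

Lemma cjX (z : R[i]) n : cj (z ^+ n) = cj z ^+ n.
Proof. exact: (rmorphXn (@conjc R)). Qed.

Lemma cj_sum (I : Type) (r : seq I) (F : I -> R[i]) :
  cj (\sum_(i <- r) F i) = \sum_(i <- r) cj (F i).
Proof. exact: (rmorph_sum (@conjc R)). Qed.

Lemma conj_ray e : cj (ray e) = - ray e :> R[i].
Proof. by apply/eqP; rewrite eq_complex /= oppr0 !eqxx. Qed.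

Lemma rayM (t e : R) : ray (t * e) = t%:C * ray e.
Proof. by apply/eqP; rewrite eq_complex /= !mul0r !mulr0 subr0 addr0 mulrN !eqxx. Qed.

Lemma vanishes_div_ray k l (f : R -> R[i]) :
  vanishes (k + l) f -> vanishes k (fun e => f e / ray e ^+ l).
Proof.
move=> /vanishes_div /(vanishesZ (Complex 0 1 ^+ l)); apply: eq_vanishes => e e0.
have en0 : e%:C != 0 :> R[i] by rewrite eq_complex /= (gt_eqF e0).
have rn0 : ray e != 0 by rewrite ray_neq0 ?gt_eqF.
have iE : Complex 0 1 = e%:C / ray e :> R[i].
  apply: (mulIf rn0); rewrite mulfVK//; apply/eqP.
  by rewrite eq_complex /= !mul0r !mul1r !addr0 sub0r opprK !eqxx.
rewrite iE exprMn exprVn.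
by field; rewrite !expf_neq0.
Qed.

(** Distinct positive nodes: the points $1/\mathrm{ray}(\mathrm{node}_i e)$ lie in the upper
    half-plane, and the matrix of powers of the nodes is invertible. *)
Definition node (i : 'I_3) : R := i.+1%:R.

Definition pt (i : 'I_3) (e : R) : R[i] := ray (node i * e).

Lemma node_gt0 i : 0 < node i. Proof. by rewrite ltr0n. Qed.

Lemma ptE i e : pt i e = (node i)%:C * ray e. Proof. exact: rayM. Qed.

Lemma conj_pt i e : cj (pt i e) = - pt i e. Proof. exact: conj_ray. Qed.

Lemma vanishes_pt i : vanishes 1 (pt i).
Proof. exact: (vanishes_scale (node_gt0 i) vanishes_ray). Qed.

Lemma vanishes_conj_pt i : vanishes 1 (fun e => cj (pt i e)).
Proof. exact: vanishes_conj (vanishes_pt i). Qed.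

(** * Weights that extract the coefficients of a kernel *)

Section test_vector.
Variable v : nat -> R.

(* Row k of the inverse of the matrix (node i ^ l), l = 1, 2, 3. *)
Definition dual_node (k i : nat) : R := nth 0 (nth [::]
  [:: [:: 3; - (3 / 2); 1 / 3]; [:: - (5 / 2); 2; - (1 / 2)];
      [:: 1 / 2; - (1 / 2); 1 / 6]] k) i.

(* The weights satisfy \sum_i weight i e * pt i e ^+ k.+1 = v k for k < 3: the
   quadratic form they define extracts the coefficients of the expansion of a
   kernel, see power_sum_lim. *)
Definition weight_num (i : 'I_3) (e : R) : R[i] :=
  (v 0%N * dual_node 0 i)%:C * ray e ^+ 2 + (v 1%N * dual_node 1 i)%:C * ray e
  + (v 2%N * dual_node 2 i)%:C.

Definition weight (i : 'I_3) (e : R) : R[i] := weight_num i e / ray e ^+ 3.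

Definition power_sum (l : nat) (e : R) : R[i] := \sum_i weight i e * pt i e ^+ l.

(** Extension by zero: the limits of all power sums, including those of order above three. *)
Definition vtrunc (k : nat) : R := if (k < 3)%N then v k else 0.

Lemma vanishes_weight_num i : vanishes 0 (weight_num i).
Proof.
apply: vanishesD; last exact: vanishes_cst.
apply: vanishesD; apply: vanishesZ.
  by apply: (@vanishes_weak _ (1 * 2)) => //; apply: vanishesX; exact: vanishes_ray.
by apply: (@vanishes_weak _ 1) => //; exact: vanishes_ray.
Qed.

(** For $k<3$ the equality is exact by the choice of the dual nodes. For $k\ge3$ the power $e^{k+1}$
    outweighs the weights, of size $e^{-3}$. *)
Lemma power_sum_lim k : vanishes 1 (fun e => power_sum k.+1 e - (vtrunc k)%:C).
Proof.
have [k3|k3] := ltnP k 3; last first.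
  rewrite /vtrunc ltnNge k3 /= -(subnK k3); move: (k - 3)%N => m.
  have : vanishes 1 (fun e => \sum_i (weight_num i e * (node i)%:C ^+ (m.+1 + 3)) * ray e ^+ m.+1).
    apply: vanishes_sum => i; rewrite -[1%N]add0n; apply: vanishesM.
      by rewrite -[0%N]addn0; apply: vanishesM; [exact: vanishes_weight_num|exact: vanishes_cst].
    apply: (@vanishes_weak _ (1 * m.+1)); first by rewrite mul1n.
    by apply: vanishesX; exact: vanishes_ray.
  apply: eq_vanishes => e e0; rewrite subr0; apply: eq_bigr => i _.
  have rn0 : ray e != 0 by rewrite ray_neq0 ?gt_eqF.
  rewrite /weight ptE exprMn -addSn [ray e ^+ (m.+1 + 3)]exprD.
  by move: (_ ^+ (m.+1 + 3)) (ray e ^+ m.+1) => x y; field.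
apply: eq_vanishes (vanishes0 1) => e e0.
have rn0 : ray e != 0 by rewrite ray_neq0 ?gt_eqF.
apply/esym/eqP; rewrite subr_eq0 /vtrunc k3 /power_sum !big_ord_recl big_ord0; apply/eqP.
rewrite /weight /weight_num !ptE /node /dual_node /= /bump /=.
by case: k k3 => [|[|[|//]]] _ /=; rewrite !addn0 ?add1n; field.
Qed.

Lemma power_sum_bounded k : vanishes 0 (power_sum k.+1).
Proof.
have := vanishesD (vanishes_weak (leq0n 1) (power_sum_lim k)) (vanishes_cst (vtrunc k)%:C).
by apply: eq_vanishes => e _; rewrite subrK.
Qed.

Definition quad (X : 'I_3 -> 'I_3 -> R -> R[i]) (e : R) : R[i] :=
  \sum_i \sum_j weight i e * cj (weight j e) * X i j e.

Lemma quadD X Y e : quad (fun i j e => X i j e + Y i j e) e = quad X e + quad Y e.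
Proof.
rewrite /quad -big_split; apply: eq_bigr => i _; rewrite -big_split; apply: eq_bigr => j _.
by rewrite mulrDr.
Qed.

Lemma quadZ c X e : quad (fun i j e => c * X i j e) e = c * quad X e.
Proof.
rewrite /quad mulr_sumr; apply: eq_bigr => i _; rewrite mulr_sumr; apply: eq_bigr => j _.
by rewrite mulrCA.
Qed.

Lemma eq_quad X Y e : (forall i j, X i j e = Y i j e) -> quad X e = quad Y e.
Proof.
by move=> XY; apply: eq_bigr => i _; apply: eq_bigr => j _; rewrite XY.
Qed.

(** Two weights cost $e^{-6}$, which is why kernels are compared up to order seven. *)
Lemma vanishes_quad X : (forall i j, vanishes 7 (X i j)) -> vanishes 1 (quad X).
Proof.
move=> X7; apply: vanishes_sum => i; apply: vanishes_sum => j.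
have h := vanishesM (vanishesM (vanishes_weight_num i) (vanishes_conj (vanishes_weight_num j))) (X7 i j).
(* The sign is that of $\overline{\mathrm{ray}}^{\,3}=-\mathrm{ray}^3$ in the denominator of the
   conjugate weight. *)
apply: eq_vanishes (vanishesN (@vanishes_div_ray 1 6 _ h)) => e e0.
have rn0 : ray e != 0 by rewrite ray_neq0 ?gt_eqF.
rewrite /weight cjM cjV cjX conj_ray.
by field; rewrite rn0.
Qed.

(* The triple (c, k, l) stands for the monomial c x ^ (k + 1) y ^ (l + 1). *)
Definition polykernel (L : seq (R * nat * nat)) (i j : 'I_3) (e : R) : R[i] :=
  \sum_(t <- L) t.1.1%:C * pt i e ^+ t.1.2.+1 * cj (pt j e) ^+ t.2.+1.

Lemma quad_polykernel L e : quad (polykernel L) e =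
  \sum_(t <- L) t.1.1%:C * power_sum t.1.2.+1 e * cj (power_sum t.2.+1 e).
Proof.
rewrite /quad; under eq_bigr do under eq_bigr do rewrite mulr_sumr.
under eq_bigr do rewrite exchange_big.
rewrite exchange_big; apply: eq_bigr => t _.
rewrite /power_sum cj_sum -mulrA mulr_suml mulr_sumr; apply: eq_bigr => i _.
by rewrite !mulr_sumr; apply: eq_bigr => j _; rewrite cjM cjX; ring.
Qed.

Lemma vanishes_quad_polykernel L : vanishes 0 (quad (polykernel L)).
Proof.
apply: eq_vanishes (_ : vanishes 0 (fun e => \sum_(t <- L) _)) => [e _|].
  by rewrite quad_polykernel.
apply: vanishes_sum => t; rewrite -[0%N]addn0; apply: vanishesM.
  by apply: vanishesZ; exact: power_sum_bounded.
by apply: vanishes_conj; exact: power_sum_bounded.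
Qed.

Lemma quad_polykernel_lim L : vanishes 1 (fun e => quad (polykernel L) e -
  (\sum_(t <- L) t.1.1 * vtrunc t.1.2 * vtrunc t.2)%:C).
Proof.
have : vanishes 1 (fun e => \sum_(t <- L) t.1.1%:C *
    ((power_sum t.1.2.+1 e - (vtrunc t.1.2)%:C) * cj (power_sum t.2.+1 e)
     + (vtrunc t.1.2)%:C * cj (power_sum t.2.+1 e - (vtrunc t.2)%:C))).
  apply: vanishes_sum => t; apply: vanishesZ; apply: vanishesD.
    rewrite -[1%N]addn0; apply: vanishesM; first exact: power_sum_lim.
    by apply: vanishes_conj; exact: power_sum_bounded.
  by apply: vanishesZ; apply: vanishes_conj; exact: power_sum_lim.
apply: eq_vanishes => e _; rewrite quad_polykernel rmorph_sum -sumrB; apply: eq_bigr => t _.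
by rewrite !rmorphM /= cjB conjc_real; ring.
Qed.

End test_vector.

(** The successors come from the shifted exponents: $(k+1)+(k'+1)=(k+k'+1)+1$. *)
Definition mul_terms (L1 L2 : seq (R * nat * nat)) : seq (R * nat * nat) :=
  [seq (t.1.1 * u.1.1, (t.1.2 + u.1.2).+1, (t.2 + u.2).+1) | t <- L1, u <- L2].

Lemma polykernelM L1 L2 i j e :
  polykernel (mul_terms L1 L2) i j e = polykernel L1 i j e * polykernel L2 i j e.
Proof.
rewrite /polykernel big_allpairs_dep mulr_suml; apply: eq_bigr => t _.
rewrite mulr_sumr; apply: eq_bigr => u _.
have E (x : R[i]) (k l : nat) : x ^+ (k + l).+2 = x ^+ k.+1 * x ^+ l.+1.
  by rewrite -exprD addSn addnS.
by rewrite rmorphM !E; ring.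
Qed.

Lemma vanishes_polykernel L i j : vanishes 2 (polykernel L i j).
Proof.
apply: vanishes_sum => t; rewrite -[2%N]/(1 + 1)%N; apply: vanishesM.
  apply: vanishesZ; apply: (@vanishes_weak _ (1 * t.1.2.+1)); first by rewrite mul1n.
  by apply: vanishesX; exact: vanishes_pt.
apply: (@vanishes_weak _ (1 * t.2.+1)); first by rewrite mul1n.
by apply: vanishesX; exact: vanishes_conj_pt.
Qed.

(** All monomials with $k+l\le4$, so that the kernel is exactly the difference quotient of a
    polynomial; those with $k$ or $l$ above 2 disappear in the limit through [vtrunc]. *)
Definition hankel_terms (kappa : nat -> R) : seq (R * nat * nat) :=
  [seq (kappa (k + l + 2)%N, k, l) | k <- iota 0 5, l <- iota 0 (5 - k)].

Lemma hankel_terms_quad kappa v :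
  \sum_(t <- hankel_terms kappa) t.1.1 * vtrunc v t.1.2 * vtrunc v t.2 =
  kappa 2%N * v 0%N ^+ 2 + kappa 4%N * v 1%N ^+ 2 + kappa 6%N * v 2%N ^+ 2
  + 2 * kappa 3%N * v 0%N * v 1%N + 2 * kappa 4%N * v 0%N * v 2%N
  + 2 * kappa 5%N * v 1%N * v 2%N.
Proof.
rewrite /hankel_terms /= !big_cons big_nil /vtrunc /=; ring.
Qed.

Lemma pt_sub_conj_neq0 i j e : 0 < e -> pt i e - cj (pt j e) != 0.
Proof.
move=> e0; rewrite conj_pt opprK !ptE -mulrDl -rmorphD mulf_neq0 ?ray_neq0 ?gt_eqF//.
by rewrite ltcR addr_gt0 ?node_gt0.
Qed.

(** Rests on $xy(x^m-y^m)/(x-y)=\sum_{k+l=m-1}x^{k+1}y^{l+1}$. *)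
Lemma polykernel_hankel kappa i j e : 0 < e ->
  polykernel (hankel_terms kappa) i j e =
  pt i e * cj (pt j e) * (\sum_(k < 6) (kappa k.+1)%:C * pt i e ^+ k -
    \sum_(k < 6) (kappa k.+1)%:C * cj (pt j e) ^+ k) / (pt i e - cj (pt j e)).
Proof.
move=> e0; have nz := pt_sub_conj_neq0 i j e0.
rewrite /polykernel; move: (pt i e) (cj (pt j e)) nz => x y nz.
rewrite /hankel_terms /= !big_cons big_nil /= !big_ord_recl !big_ord0 /= /bump /=.
by field.
Qed.

(** * The Pick kernel of a free root at three points *)

Section pick_limit.
Variables (mu nu : probability (measurableTypeR R) R) (n : nat) (a b r : R).
Variables (psi : R[i] -> R[i]) (kappa v : nat -> R).
Hypotheses (r0 : 0 < r) (mur : mu (~` `[- r, r]%classic) = 0%E).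
Hypotheses (n0 : (0 < n)%N) (a0 : 0 < a) (b0 : 0 < b).
Hypothesis Vnu : voiculescu_transform nu a b psi.
Hypothesis Vmu : voiculescu_transform mu a b (fun z => n%:R * psi z).
Hypothesis mk : moment_cumulant (moment mu) kappa.

Let L := hankel_terms kappa.
Let B i j e := polykernel L i j e.
Let phi z := n%:R * psi z.
Let rho i e := phi (pt i e)^-1 - \sum_(k < 6) (kappa k.+1)%:C * pt i e ^+ k.
Let A i j e := pt i e * cj (pt j e) * (phi (pt i e)^-1 - cj (phi (pt j e)^-1))
  / (pt i e - cj (pt j e)).
Let I i j e := (1 - n%:R^-1 * A i j e)^-1.
Let w i e := (pt i e)^-1 + psi (pt i e)^-1.
(** The largest node is 3, so below this bound all three points lie in the cone. *)
Let d := (3 * b)^-1.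

Let d0 : 0 < d. Proof. by rewrite invr_gt0 mulr_gt0. Qed.

Let nC0 : n%:R != 0 :> R[i]. Proof. by rewrite pnatr_eq0 -lt0n. Qed.

Let rho6 i : vanishes 6 (rho i).
Proof.
exact: (vanishes_scale (node_gt0 i) (voiculescu_expansion r0 mur a0 b0 Vmu mk)).
Qed.

Let pt_neq0 i e : 0 < e -> pt i e != 0.
Proof. by move=> e0; rewrite ray_neq0 ?gt_eqF// mulr_gt0 ?node_gt0. Qed.

(** The order count is $1+1+6-1$: two factors [pt], the error of the expansion of $\varphi_\mu$, and
    the division by $x-y$. *)
Let AB7 i j : vanishes 7 (fun e => A i j e - B i j e).
Proof.
have h := vanishesM (vanishesM (vanishes_pt i) (vanishes_conj_pt j))
  (vanishesB (rho6 i) (vanishes_conj (rho6 j))).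
have := vanishesZ ((node i + node j)%:C)^-1 (@vanishes_div_ray 7 1 _ h).
apply: eq_vanishes => e e0; have nz := pt_sub_conj_neq0 i j e0.
have pE : pt i e - cj (pt j e) = (node i + node j)%:C * ray e.
  by rewrite conj_pt opprK !ptE -mulrDl -rmorphD.
have rn0 : ray e != 0 by rewrite ray_neq0 ?gt_eqF.
have nn0 : (node i + node j)%:C != 0 :> R[i].
  by apply: contraNneq nz => h0; rewrite pE h0 mul0r.
rewrite /B /L polykernel_hankel// /A /rho cjB cj_sum expr1.
have -> : \sum_(k < 6) cj ((kappa k.+1)%:C * pt j e ^+ k) =
    \sum_(k < 6) (kappa k.+1)%:C * cj (pt j e) ^+ k.
  by apply: eq_bigr => k _; rewrite cjM cjX conjc_real.
rewrite pE; move: (\sum_(k < 6) _) (\sum_(k < 6) _) => S T.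
move: (phi _) (cj (phi _)) => x y.
by move: (node i + node j)%:C nn0 => N nn0; field; rewrite rn0 nn0.
Qed.

Let B2 i j : vanishes 2 (B i j). Proof. exact: vanishes_polykernel. Qed.

Let A2 i j : vanishes 2 (A i j).
Proof.
have := vanishesD (vanishes_weak (isT : 2 <= 7)%N (AB7 i j)) (B2 i j).
by apply: eq_vanishes => e _; rewrite subrK.
Qed.

Let I0 i j : vanishes 0 (I i j).
Proof.
by apply: vanishes_inv1B; apply: vanishesZ; exact: (vanishes_weak (isT : 1 <= 2)%N (A2 i j)).
Qed.

Let w_near i e : 0 < e < d ->
  0 < complex.Im (w i e) /\ reciprocal_cauchy nu (w i e) = (pt i e)^-1.
Proof.
move=> /andP[e0 ed]; have [l [M [_ M0 _ h]]] := Vnu.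
have [|[Mw _] Fw] := h (pt i e)^-1; last by split => //; exact: lt_trans Mw.
apply: ray_cone => //; rewrite mulr_gt0 ?node_gt0//=.
apply: (@le_lt_trans _ _ (3 * e)); first by rewrite ler_wpM2r ?(ltW e0)// ler_nat ltn_ord.
by move: ed; rewrite /d invfM mulrC ltr_pdivlMr// mulrC.
Qed.

(* With A the difference quotient of - phi at the points z_i and conj z_j, one has
   w_i - conj w_j = (z_i - conj z_j) (1 - A / n). *)
Let pick_term i j e : 0 < e < d -> 1 - n%:R^-1 * A i j e != 0 /\
  n%:R * (((pt i e)^-1 - cj (pt j e)^-1) / (w i e - cj (w j e)) - 1) = A i j e * I i j e.
Proof.
move=> ed; have /andP[e0 _] := ed.
have [wi _] := w_near i ed; have [wj _] := w_near j ed.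
have nz := pt_sub_conj_neq0 i j e0.
have pi0 := pt_neq0 i e0; have pj0 : cj (pt j e) != 0 by rewrite conjc_eq0 pt_neq0.
have wE : w i e - cj (w j e) =
    (cj (pt j e) - pt i e) / (pt i e * cj (pt j e)) * (1 - n%:R^-1 * A i j e).
  rewrite /w cjD cjV /A /phi !cjM (conjc_nat R n).
  move: (psi _) (cj (psi _)) nz pi0 pj0 => x y.
  move: (pt i e) (cj (pt j e)) => p q nz pi0 pj0.
  by field; rewrite nC0 nz pi0 pj0.
have h1 : 1 - n%:R^-1 * A i j e != 0.
  by apply: contraNneq (sub_conj_neq0 wi wj) => h; rewrite wE h mulr0.
split=> //; rewrite wE /I cjV.
have nz' : cj (pt j e) - pt i e != 0 by rewrite -opprB oppr_eq0.
move: h1; rewrite -(mulVKf nC0 (A i j e)); set Y := n%:R^-1 * A i j e.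
rewrite mulKf// => h1.
by field; rewrite nz' pi0 pj0 h1.
Qed.

(** The series of $A/(1-A/n)$ stops after $A^3/n^2$, since $A=O(e^2)$ makes the remainder $O(e^8)$;
    then [A] is replaced by [B] in the three terms kept. *)
Let X7 i j : vanishes 7 (fun e => A i j e * I i j e -
  (B i j e + n%:R^-1 * (B i j e * B i j e) + n%:R^-2 * (B i j e * (B i j e * B i j e)))).
Proof.
have h1 := AB7 i j; have hA := A2 i j; have hB := B2 i j.
have h2 := vanishes_weak (isT : 7 <= 7 + 2)%N (vanishesM h1 (vanishesD hA hB)).
have h3 := vanishes_weak (isT : 7 <= 7 + (2 + 2))%N (vanishesM h1
  (vanishesD (vanishesD (vanishesM hA hA) (vanishesM hA hB)) (vanishesM hB hB))).
have h4 := vanishes_weak (isT : 7 <= (2 + 2) + (2 + 2) + 0)%N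
  (vanishesM (vanishesM (vanishesM hA hA) (vanishesM hA hA)) (I0 i j)).
have := vanishesD (vanishesD (vanishesD h1 (vanishesZ (n%:R^-1) h2)) (vanishesZ (n%:R ^- 2) h3))
  (vanishesZ (n%:R ^- 3) h4).
apply: (vanishes_near d0) => e ed; have [nz _] := pick_term i j ed.
rewrite /I -!exprVn; move: (A i j e) (B i j e) (n%:R^-1) nz => x y M nz.
by field.
Qed.

(** The three forms are built from the cumulants and [v] only; the root enters through $n$, [g] and
    [d]. *)
Lemma pick_quad_ge0 : exists2 g, vanishes 1 g &
  forall e, 0 < e < d -> 0 <= quad v (polykernel L) e
    + n%:R^-1 * quad v (polykernel (mul_terms L L)) e
    + n%:R^-2 * quad v (polykernel (mul_terms L (mul_terms L L))) e + g e.
Proof.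
exists (quad v (fun i j e => A i j e * I i j e -
  (B i j e + n%:R^-1 * (B i j e * B i j e) + n%:R^-2 * (B i j e * (B i j e * B i j e))))).
  exact: vanishes_quad.
move=> e ed.
have := @pick_kernel_ge0 _ nu 3 (fun i => w i e) (fun i => weight v i e).
move=> /(_ (fun i => (w_near i ed).1)) h.
have {h} : 0 <= quad v (fun i j e => A i j e * I i j e) e.
  have /h : forall i, reciprocal_cauchy nu (w i e) != 0.
    by move=> i; rewrite (w_near i ed).2 invr_eq0 pt_neq0//; case/andP: ed.
  move=> /(mulr_ge0 (ler0n _ n)); congr (0 <= _).
  rewrite mulr_sumr; apply: eq_bigr => i _; rewrite mulr_sumr; apply: eq_bigr => j _.
  by rewrite mulrCA (w_near i ed).2 (w_near j ed).2 (pick_term i j ed).2.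
congr (0 <= _).
rewrite -!quadZ -!quadD; apply: eq_quad => i j.
by rewrite !polykernelM -/(B i j e) [RHS]addrC subrK.
Qed.

End pick_limit.

Theorem freely_infinitely_divisible_hankel (mu : probability (measurableTypeR R) R)
    (r : R) (kappa : nat -> R) (x y z : R) :
  0 < r -> mu (~` `[- r, r]%classic) = 0%E -> moment_cumulant (moment mu) kappa ->
  freely_infinitely_divisible mu ->
  0 <= kappa 2%N * x ^+ 2 + kappa 4%N * y ^+ 2 + kappa 6%N * z ^+ 2
  + 2 * kappa 3%N * x * y + 2 * kappa 4%N * x * z + 2 * kappa 5%N * y * z.
Proof.
move=> r0 mur mk fid; pose v k := nth 0 [:: x; y; z] k.
rewrite [leRHS](_ : _ = \sum_(t <- hankel_terms kappa) t.1.1 * vtrunc v t.1.2 * vtrunc v t.2);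
  last by rewrite hankel_terms_quad.
set Q := \sum_(t <- _) _.
pose L := hankel_terms kappa.
have [C0 [d0 [d00 h0]]] := quad_polykernel_lim v L.
have [C1 [d1 [d10 h1]]] := vanishes_quad_polykernel v (mul_terms L L).
have [C2 [d2 [d20 h2]]] := vanishes_quad_polykernel v (mul_terms L (mul_terms L L)).
have Re_ge (c : R[i]) (K : R) : `|c| <= K%:C -> complex.Re c <= K.
  move=> cK; rewrite -lecR; apply: le_trans cK; apply: le_trans (normc_ge_Re c).
  by rewrite lecR ler_norm.
(* The limit $e\to0$ for fixed $n$. [C1] and [C2] were chosen before $n$, which makes the second
   limit possible; $n\ge2$ excludes the first case of [free_power_voiculescu]. *)
have step n : (2 <= n)%N -> 0 <= Q + n%:R^-1 * (`|C1| + `|C2|).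
  move=> n2; have n0 : (0 < n)%N by exact: ltnW.
  have [mun pn] := fid n n0.
  have [[n1 _]|[a [b [psi [a0 b0 Vn V]]]]] := free_power_voiculescu pn.
    by rewrite n1 in n2.
  have [g [C [d [dd0 hg]]] pos] := pick_quad_ge0 v r0 mur n0 a0 b0 Vn V mk.
  rewrite leNgt; apply/negP => neg.
  set T := Q + _ in neg.
  pose K := `|C0| + `|C| + 1; have K0 : 0 < K by rewrite ltr_wpDl ?addr_ge0.
  (* The last bound keeps the total error at most $-T/2$, too small to make up for a negative $T$;
     the domains of the estimates are open, so half of this value is used. *)
  pose e := Num.min (Num.min (Num.min d0 d1) (Num.min d2 d)) (Num.min (3 * b)^-1 (- T / (2 * K))).
  have e0 : 0 < e.
    rewrite !lt_min d00 d10 d20 dd0 invr_gt0 mulr_gt0//= divr_gt0 ?mulr_gt0//.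
    by rewrite oppr_gt0.
  pose e' := e / 2.
  have e'0 : 0 < e' by rewrite divr_gt0.
  have e'e : e' < e by rewrite /e'; lra.
  have : e <= e by []. rewrite {2}/e !le_min.
  move=> /andP[/andP[/andP[ed0 ed1] /andP[ed2 edd]] /andP[edb edT]].
  have {}h0 := h0 e'; have {}h1 := h1 e'; have {}h2 := h2 e'; have {}hg := hg e'.
  have {}h0 := Re_ge _ _ (h0 ltac:(rewrite e'0; exact: lt_le_trans ed0)).
  have {}h1 := Re_ge _ _ (h1 ltac:(rewrite e'0; exact: lt_le_trans ed1)).
  have {}h2 := Re_ge _ _ (h2 ltac:(rewrite e'0; exact: lt_le_trans ed2)).
  have {}hg := Re_ge _ _ (hg ltac:(rewrite e'0; exact: lt_le_trans edd)).
  have := pos e' ltac:(rewrite e'0; exact: lt_le_trans edb).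
  rewrite lecE => /andP[_].
  have invE m : (n%:R ^- m : R[i]) = (n%:R ^- m)%:C.
    by rewrite fmorphV rmorphXn rmorph_nat.
  have invE1 : (n%:R^-1 : R[i]) = (n%:R^-1)%:C by rewrite fmorphV rmorph_nat.
  have ReD (c c' : R[i]) : complex.Re (c + c') = complex.Re c + complex.Re c' by case: c; case: c'.
  rewrite invE invE1 !ReD !complexReM /= !mul0r !subr0.
  move: h0; rewrite -[quad _ _ _ - _]/(quad v (polykernel L) e' + - Q%:C) ReD /= => h0.
  move: h0 h1 h2 hg; rewrite !expr0 !expr1 !mulr1.
  move: (complex.Re (quad _ (polykernel L) _)) (complex.Re (quad _ (polykernel (mul_terms L L)) _)).
  move: (complex.Re (quad _ _ _)) (complex.Re (g _)) => q2 qg q0 q1 h0 h1 h2 hg.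
  have i0 : 0 < n%:R^-1 :> R by rewrite invr_gt0 ltr0n.
  have i1 : n%:R^-1 <= 1 :> R by rewrite invf_le1 ?ler1n ?ltr0n.
  have b1 : n%:R^-1 * q1 <= n%:R^-1 * `|C1|.
    by rewrite ler_pM2l//; apply: le_trans h1 (ler_norm _).
  have b2 : n%:R ^- 2 * q2 <= n%:R^-1 * `|C2|.
    rewrite -exprVn expr2 -mulrA ler_pM2l//; apply: le_trans (_ : 1 * `|C2| <= _); last by rewrite mul1r.
    apply: le_trans (_ : n%:R^-1 * `|C2| <= _); last by rewrite ler_wpM2r.
    by rewrite ler_pM2l//; apply: le_trans h2 (ler_norm _).
  have bn (c : R) : c * e' <= `|c| * e' by rewrite ler_wpM2r ?ler_norm// ltW.
  have b0' := bn C0; have bg := bn C.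
  have eK : (`|C0| + `|C|) * e' <= - T / 2.
    apply: le_trans (_ : K * e' <= _); first by rewrite ler_wpM2r ?(ltW e'0)// /K lerDl.
    have : e' <= - T / (2 * K) by apply: le_trans (ltW e'e) edT.
    by rewrite ler_pdivlMr ?mulr_gt0//; lra.
  have TE : T = Q + (n%:R^-1 * `|C1| + n%:R^-1 * `|C2|) by rewrite /T mulrDr.
  by lra.
rewrite leNgt; apply/negP => Q0.
pose E := `|C1| + `|C2| + 1; have E0 : 0 < E by rewrite ltr_wpDl ?addr_ge0.
(* Any $n>E/(-Q)$ contradicts [step]; the two successors ensure $n\ge2$. *)
pose n := (Num.bound (E / - Q)).+2.
have := step n isT; apply/negP; rewrite -ltNge.
have nE : E / - Q < n%:R.
  apply: lt_le_trans (archi_boundP _) _; first by rewrite divr_ge0 ?(ltW E0)// oppr_ge0 ltW.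
  by rewrite ler_nat /n -addn2 leq_addr.
move: nE; rewrite ltr_pdivrMr ?oppr_gt0// => nE.
have n0 : 0 < n%:R :> R by rewrite ltr0n.
rewrite -(ltr_pM2l n0) mulr0 mulrDr mulVKf ?gt_eqF//.
by move: nE; rewrite /E; lra.
Qed.

End hankel_positivity.

(** * The determinant criterion and the beta law *)

Theorem freely_infinitely_divisible_D2_ge0 (R : realType)
    (mu : probability (measurableTypeR R) R) (r : R) :
  0 < r -> mu (~` `[- r, r]%classic) = 0%E ->
  freely_infinitely_divisible mu -> 0 <= D2 mu.
Proof.
move=> r0 mur fid; rewrite /D2 det3_sum.
have := psd3_det_ge0 (fun x y z => freely_infinitely_divisible_hankel x y z r0 mur
  (free_cumulantP mu) fid).
congr (0 <= _); ring.
Qed.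

Theorem mainTheorem6 (R : realType) (p q : R) (p0 : 0 < p) (q0 : 0 < q) :
  let s := p + q in
  let u := p * q / (p + q) ^+ 2 in
  [/\ 0 < u <= 1 / 4,
      D2 (beta_distribution p0 q0) =
        u ^+ 3 * P2 s u /
        ((s + 1) ^+ 6 * (s + 2) ^+ 4 * (s + 3) ^+ 3 * (s + 4) ^+ 2 * (s + 5)) &
      P2 s u < 0 -> ~ freely_infinitely_divisible (beta_distribution p0 q0)].
Proof.
move=> s u; have s0 : 0 < s by rewrite addr_gt0.
have u0 : 0 < u by rewrite divr_gt0 ?mulr_gt0 ?exprn_gt0.
have D2E : D2 (beta_distribution p0 q0) = u ^+ 3 * P2 s u /
    ((s + 1) ^+ 6 * (s + 2) ^+ 4 * (s + 3) ^+ 3 * (s + 4) ^+ 2 * (s + 5)).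
  (* In terms of the mean, $u=x(1-x)$ and $1-4u=(1-2x)^2$. *)
  pose x := p / s.
  have uE : u = x * (1 - x) by rewrite /u /x /s; field; rewrite gt_eqF.
  have mS n : moment (beta_distribution p0 q0) n.+1 =
      (x * s + n%:R) / (s + n%:R) * moment (beta_distribution p0 q0) n.
    by rewrite beta_momentS /x mulfVK ?gt_eqF.
  have [k2 k3 k4 k5 k6] := beta_free_cumulants s0
    (free_cumulantP (beta_distribution p0 q0)) (beta_moment0 p0 q0) mS.
  rewrite -uE in k2 k3 k4 k5 k6.
  rewrite /D2 det3_sum; apply: (D2_identity s0 _ k2 k3 k4 k5 k6).
  by rewrite uE; ring.
split => //.
  rewrite u0 ler_pdivrMr ?exprn_gt0// -subr_ge0.
  rewrite (_ : _ - _ = (p - q) ^+ 2 / 4); last by field.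
  by rewrite divr_ge0 ?sqr_ge0.
move=> P0 fid; have : 0 <= D2 (beta_distribution p0 q0).
  (* The law lives on $(0,1)\subset[-1,1]$, so $r=1$ works. *)
  apply: (freely_infinitely_divisible_D2_ge0 ltr01 _ fid).
  apply/eqP; rewrite -measure_le0 -(beta_distribution_supp p0 q0).
  apply: le_measure; rewrite ?inE; [exact: measurableC|exact: measurableC|].
  by apply: subsetC => x /=; rewrite !in_itv/=; lra.
have pos c k : 0 < c -> 0 < (s + c) ^+ k by move=> c0; rewrite exprn_gt0 ?addr_gt0.
rewrite D2E pmulr_lge0; last first.
  by rewrite invr_gt0 !pmulr_rgt0 ?pos ?addr_gt0// !mulr_gt0 ?pos.
by rewrite pmulr_rge0 ?exprn_gt0// leNgt P0.
Qed.
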